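(* Let $v$ be a $C^\infty$-smooth vector field on $S^1=\mathbb R/2\pi\mathbb Z$ having coprime harmonics, and let $\Lambda$ be the Lie algebra generated by the constant vector field $\frac{d}{dx}$, the commutator $v'=[\frac{d}{dx},v]$ and the images of $v'$ under all the rotations of the circle. Then there is the following alternative: - either $v(x)=a\sin x+b\cos x+c$ for some $a,b,c\in\mathbb R$, and the Lie algebra $\Lambda$ coincides with the Lie algebra of the Möbius group $PSL_2(\mathbb R)$ of conformal automorphisms of the unit disk (acting on its boundary circle); - or $\Lambda$ is $C^\infty$-dense in the space $\chi(S^1)$ of $C^\infty$ vector fields on $S^1$.
   Context: A vector field $v(x)\frac{d}{dx}$ on $S^1$ is identified with the $2\pi$-periodic real function $v(x)$. Write its Fourier series as $v(x)=\sum_{k\in\mathbb Z}a_ke^{ikx}$, $a_k\in\mathbb C$. Define $m(v)$ to be the greatest common divisor of the set $\{k\in\mathbb Z\setminus\{0\}\mid a_k\neq0\}$. The field $v$ is said to have coprime harmonics if $m(v)=1$. Lie algebras generated by vector fields are real Lie subalgebras of the Lie algebra $\chi(S^1)$ of $C^\infty$ vector fields on $S^1$. The unit circle $\{|z|=1\}$ is identified with $S^1$ via $z=e^{ix}$, so that the Lie algebra of the Möbius group of conformal automorphisms of the unit disk is regarded as a Lie subalgebra of $\chi(S^1)$. *)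

(* Defs.v *)
From Stdlib Require Import Reals ZArith.
From Coquelicot Require Import Coquelicot.
Local Open Scope R_scope.

(* A vector field v(x) d/dx on S^1 = R/2piZ is represented by its coefficient,
   a 2pi-periodic function R -> R; [chi] is the space of smooth vector fields. *)
Definition periodic (v : R -> R) : Prop := forall x, v (x + 2 * PI) = v x.

Definition smooth (v : R -> R) : Prop := forall n x, ex_derive_n v n x.

Definition chi (v : R -> R) : Prop := periodic v /\ smooth v.

Definition cis (x : R) : C := (cos x, sin x).

Definition fourier_coeff (v : R -> R) (k : Z) : C :=
  (RtoC (/ (2 * PI)) *
   RInt (V := C_R_CompleteNormedModule)
     (fun x => (RtoC (v x) * cis (- (IZR k * x)))%C) 0 (2 * PI))%C.

Definition harmonic (v : R -> R) (k : Z) : Prop :=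
  k <> 0%Z /\ fourier_coeff v k <> RtoC 0.

(* The set [S] may be infinite; the gcd of the empty set is 0. *)
Definition is_gcd_of (S : Z -> Prop) (d : Z) : Prop :=
  (0 <= d)%Z /\
  (forall k, S k -> (d | k)%Z) /\
  (forall e, (forall k, S k -> (e | k)%Z) -> (e | d)%Z).

Definition coprime_harmonics (v : R -> R) : Prop := is_gcd_of (harmonic v) 1.

(* [u d/dx, w d/dx] = (u w' - w u') d/dx *)
Definition bracket (u w : R -> R) : R -> R :=
  fun x => u x * Derive w x - w x * Derive u x.

Record lie_subalgebra (L : (R -> R) -> Prop) : Prop := {
  lie_chi : forall u, L u -> chi u;
  lie_zero : L (fun _ => 0);
  lie_add : forall u w, L u -> L w -> L (fun x => u x + w x);
  lie_scal : forall (c : R) u, L u -> L (fun x => c * u x);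
  lie_bracket : forall u w, L u -> L w -> L (bracket u w)
}.

Definition lie_generated (S : (R -> R) -> Prop) (u : R -> R) : Prop :=
  forall L, lie_subalgebra L -> (forall w, S w -> L w) -> L u.

Definition d_dx : R -> R := fun _ => 1.

(* Image of the vector field [v] under the rotation x |-> x + t. *)
Definition rotate (t : R) (v : R -> R) : R -> R := fun x => v (x - t).

Definition Lambda (v : R -> R) : (R -> R) -> Prop :=
  lie_generated (fun u =>
    u = d_dx \/ u = bracket d_dx v \/
    exists t : R, u = rotate t (bracket d_dx v)).

(* Density in [chi] for uniform convergence of all derivatives. *)
Definition Cinfty_dense (L : (R -> R) -> Prop) : Prop :=
  forall w, chi w -> forall (N : nat) (eps : R), 0 < eps ->
  exists u, L u /\
    forall (n : nat) (x : R), (n <= N)%nat ->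
      Rabs (Derive_n u n x - Derive_n w n x) < eps.

(* Moebius transformations mapping the open unit disk onto itself.  Only the
   values on the closed disk are constrained.  Injectivity follows from
   a d - b c <> 0. *)
Definition disk_automorphism (g : C -> C) : Prop :=
  (exists a b c d : C,
     (a * d - b * c)%C <> RtoC 0 /\
     forall z : C, Cmod z <= 1 ->
       (c * z + d)%C <> RtoC 0 /\ g z = ((a * z + b) / (c * z + d))%C) /\
  (forall z : C, Cmod z < 1 -> Cmod (g z) < 1) /\
  (forall w : C, Cmod w < 1 -> exists z : C, Cmod z < 1 /\ g z = w).

Definition one_parameter_group (g : R -> C -> C) : Prop :=
  (forall t, disk_automorphism (g t)) /\
  (forall z, Cmod z <= 1 -> g 0 z = z) /\
  (forall s t z, Cmod z <= 1 -> g (s + t) z = g s (g t z)).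

(* Lie algebra of the group of disk automorphisms acting on the boundary
   circle: the generators of its one-parameter subgroups.  A motion
   e^(i x(t)) with x' = u(x) has velocity i u(x) e^(i x). *)
Definition moebius_lie (u : R -> R) : Prop :=
  chi u /\
  exists g : R -> C -> C, one_parameter_group g /\
    forall x : R,
      is_derive (K := R_AbsRing) (V := C_R_NormedModule)
        (fun t : R => g t (cis x)) 0 (Ci * RtoC (u x) * cis x)%C.

(* Main.v *)
Require Import Defs.
From Stdlib Require Import Reals ZArith Lra Lia FunctionalExtensionality Classical.
From Coquelicot Require Import Coquelicot.
Local Open Scope R_scope.

(** Let [C] be the closure of [Lambda v] for uniform convergence of all
    derivatives.  It is again a Lie algebra, because the bracket is continuous
    ([lie_subalgebra_Cinfty_closure]).  Averaging the rotates of [v'] against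
    [cos k x] shows that [C] contains [cos k x] and [sin k x] for every harmonic
    [k] of [v] ([waves_of_harmonic]); the average is an integral, approximated by
    Riemann sums, which are finite combinations of rotates.

    Let [K] be the set of integers [k] such that [cos k x] and [sin k x] lie in
    [C].  It is symmetric, contains 0, and contains the sum of any two of its
    distinct elements, since in complex notation the bracket of [e^(i p x)] and
    [e^(i q x)] is [i (q - p) e^(i (p + q) x)] ([wave_add_frequencies]).  If [v]
    has a harmonic [k0] other than 1 and -1, then [k0] does not divide all
    harmonics, so [K] has two nonzero elements of different absolute values.
    These make doubling possible as well ([subgroup_of_distinct_sums]), so [K] is
    a subgroup of [Z]; it contains a set with gcd 1, hence [K = Z].  Thus [C]
    contains all trigonometric polynomials, and these are dense: convolution with
    the normalized kernel [(1 + cos x)^n] commutes with differentiation and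
    converges to the identity ([approx_identity_converges]).

    Otherwise the same convolutions stay in the span of [1], [cos] and [sin],
    which is closed, so [v] lies in that span ([first_harmonic_of_harmonics]), and
    the span is the Lie algebra [Lambda v] ([Lambda_eq_first_harmonic]).  It is
    also the Moebius algebra: differentiating the invariance of the cross-ratio of
    [1], [i], [-1], [e^(i x)] along a one-parameter group determines its velocity
    at [e^(i x)] from three values ([first_harmonic_of_moebius]); conversely each
    field of the span is the velocity field of an explicit group of matrices
    [exp (t X)] in SU(1,1) ([moebius_of_first_harmonic]).  Since the span is
    closed and does not contain [cos 2x], it is not dense, which makes the
    alternative exclusive. *)

(** * Smooth periodic functions *)

Lemma Derive_n_Derive (f : R -> R) n : Derive_n (Derive f) n = Derive_n f (S n).
Proof.
  induction n as [|n IH]; [reflexivity|].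
  simpl in IH |- *. now rewrite IH.
Qed.

(** Coinduction for smoothness: a class of differentiable functions that is
    stable under differentiation consists of smooth functions. *)
Lemma smooth_of_derive_stable (P : (R -> R) -> Prop) :
  (forall f, P f -> (forall x, ex_derive f x) /\ P (Derive f)) ->
  forall f, P f -> smooth f.
Proof.
  intros HP f Hf.
  assert (H : forall n, P (Derive_n f n)).
  { induction n as [|n IH]; [exact Hf|]. exact (proj2 (HP _ IH)). }
  intros [|n] x; [exact I|]. exact (proj1 (HP _ (H n)) x).
Qed.

Lemma smooth_ex_derive f : smooth f -> forall x, ex_derive f x.
Proof. intros H x. exact (H 1%nat x). Qed.

Lemma smooth_Derive f : smooth f -> smooth (Derive f).
Proof.
  intros H [|n] x; [exact I|].
  change (ex_derive (Derive_n (Derive f) n) x).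
  rewrite Derive_n_Derive. exact (H (S (S n)) x).
Qed.

Lemma smooth_Derive_n f n : smooth f -> smooth (Derive_n f n).
Proof.
  intros H. induction n as [|n IH]; [exact H|]. exact (smooth_Derive _ IH).
Qed.

Lemma smooth_continuous f : smooth f -> forall x, continuous f x.
Proof. intros H x. apply (ex_derive_continuous f). now apply smooth_ex_derive. Qed.

Lemma smooth_is_derive f : smooth f -> forall x, is_derive f x (Derive f x).
Proof. intros H x. apply Derive_correct. now apply smooth_ex_derive. Qed.

Lemma Derive_plus_fun f g : smooth f -> smooth g ->
  Derive (fun x => f x + g x) = (fun x => Derive f x + Derive g x).
Proof.
  intros Hf Hg. apply functional_extensionality; intros x.
  apply Derive_plus; now apply smooth_ex_derive.
Qed.

Lemma Derive_scal_fun c f : Derive (fun x => c * f x) = (fun x => c * Derive f x).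
Proof. apply functional_extensionality; intros x. apply Derive_scal. Qed.

Lemma Derive_mult_fun f g : smooth f -> smooth g ->
  Derive (fun x => f x * g x) = (fun x => Derive f x * g x + f x * Derive g x).
Proof.
  intros Hf Hg. apply functional_extensionality; intros x.
  apply Derive_mult; now apply smooth_ex_derive.
Qed.

Lemma Derive_shift_fun t f : smooth f ->
  Derive (fun x => f (x - t)) = (fun x => Derive f (x - t)).
Proof.
  intros Hf. apply functional_extensionality; intros x.
  apply is_derive_unique. auto_derive; [now apply smooth_ex_derive|].
  unfold Rminus. apply Rmult_1_l.
Qed.

(** The closure of products of smooth functions under sums is stable under
    differentiation, by the Leibniz rule. *)
Inductive sum_of_smooth_products : (R -> R) -> Prop :=
| ssp_product f g : smooth f -> smooth g ->
    sum_of_smooth_products (fun x => f x * g x)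
| ssp_add h1 h2 : sum_of_smooth_products h1 -> sum_of_smooth_products h2 ->
    sum_of_smooth_products (fun x => h1 x + h2 x).

Lemma smooth_sum_of_products h : sum_of_smooth_products h -> smooth h.
Proof.
  apply smooth_of_derive_stable. clear h. intros h H.
  induction H as [f g Hf Hg|h1 h2 _ [E1 S1] _ [E2 S2]].
  - split.
    + intros x. apply (ex_derive_mult f g); now apply smooth_ex_derive.
    + rewrite Derive_mult_fun by assumption.
      apply ssp_add; apply ssp_product; auto using smooth_Derive.
  - split.
    + intros x. now apply (ex_derive_plus h1 h2).
    + replace (Derive (fun x => h1 x + h2 x))
        with (fun x => Derive h1 x + Derive h2 x); [now apply ssp_add|].
      apply functional_extensionality; intros x.
      symmetry. now apply Derive_plus.
Qed.

Lemma smooth_mult f g : smooth f -> smooth g -> smooth (fun x => f x * g x).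
Proof. intros. apply smooth_sum_of_products. now apply ssp_product. Qed.

Lemma smooth_const c : smooth (fun _ => c).
Proof.
  apply (smooth_of_derive_stable (fun f => exists c, f = fun _ => c)); [|eauto].
  intros f [d ->]. split.
  - intros x. apply ex_derive_const.
  - exists 0. apply functional_extensionality; intros x. apply Derive_const.
Qed.

Lemma smooth_scal c f : smooth f -> smooth (fun x => c * f x).
Proof. intros. apply (smooth_mult (fun _ => c)); auto using smooth_const. Qed.

Lemma smooth_plus f g : smooth f -> smooth g -> smooth (fun x => f x + g x).
Proof.
  intros Hf Hg.
  apply (smooth_of_derive_stable
    (fun h => exists f g, smooth f /\ smooth g /\ h = fun x => f x + g x)); [|eauto].
  clear. intros h (f & g & Hf & Hg & ->). split.
  - intros x. apply (ex_derive_plus f g); now apply smooth_ex_derive.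
  - exists (Derive f), (Derive g). auto using smooth_Derive, Derive_plus_fun.
Qed.

Lemma smooth_shift t f : smooth f -> smooth (fun x => f (x - t)).
Proof.
  intros Hf.
  apply (smooth_of_derive_stable
    (fun h => exists f, smooth f /\ h = fun x => f (x - t))); [|eauto].
  clear. intros h (f & Hf & ->). split.
  - intros x. auto_derive. now apply smooth_ex_derive.
  - exists (Derive f). auto using smooth_Derive, Derive_shift_fun.
Qed.

Lemma chi_plus f g : chi f -> chi g -> chi (fun x => f x + g x).
Proof.
  intros [Pf Sf] [Pg Sg]. split; [|now apply smooth_plus].
  intros x. now rewrite Pf, Pg.
Qed.

Lemma chi_mult f g : chi f -> chi g -> chi (fun x => f x * g x).
Proof.
  intros [Pf Sf] [Pg Sg]. split; [|now apply smooth_mult].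
  intros x. now rewrite Pf, Pg.
Qed.

Lemma chi_const c : chi (fun _ => c).
Proof. split; [now intros x|apply smooth_const]. Qed.

Lemma chi_scal c f : chi f -> chi (fun x => c * f x).
Proof. intros. apply (chi_mult (fun _ => c)); auto using chi_const. Qed.

Lemma chi_shift t f : chi f -> chi (fun x => f (x - t)).
Proof.
  intros [Pf Sf]. split; [|now apply smooth_shift].
  intros x. rewrite <- (Pf (x - t)). f_equal. ring.
Qed.

Lemma chi_Derive f : chi f -> chi (Derive f).
Proof.
  intros [Pf Sf]. split; [|now apply smooth_Derive].
  intros x.
  (* the derivative at x + 2 pi is that of the translate by 2 pi, which is f *)
  replace (x + 2 * PI) with (x - - (2 * PI)) by ring.
  rewrite <- (f_equal (fun h => h x) (Derive_shift_fun (- (2 * PI)) f Sf)).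
  apply Derive_ext. intros t. rewrite <- (Pf t). f_equal. ring.
Qed.

Lemma chi_Derive_n f n : chi f -> chi (Derive_n f n).
Proof. intros H. induction n as [|n IH]; [exact H|]. exact (chi_Derive _ IH). Qed.

Lemma chi_minus f g : chi f -> chi g -> chi (fun x => f x - g x).
Proof.
  intros Hf Hg. replace (fun x => f x - g x) with (fun x => f x + -1 * g x).
  - apply chi_plus; [assumption|now apply chi_scal].
  - apply functional_extensionality; intros x. ring.
Qed.

Lemma chi_bracket f g : chi f -> chi g -> chi (bracket f g).
Proof.
  intros Hf Hg. unfold bracket.
  apply (chi_minus (fun x => f x * Derive g x)); apply chi_mult;
    auto using chi_Derive.
Qed.

Lemma bracket_d_dx v : bracket d_dx v = Derive v.
Proof.
  apply functional_extensionality; intros x. unfold bracket, d_dx.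
  rewrite Derive_const. ring.
Qed.

Lemma periodic_IZR f : periodic f -> forall k x, f (x + IZR k * (2 * PI)) = f x.
Proof.
  intros Hf.
  assert (Hn : forall n x, f (x + INR n * (2 * PI)) = f x).
  { induction n as [|n IH]; intros x.
    - f_equal. simpl. ring.
    - rewrite <- (IH x), <- (Hf (x + INR n * (2 * PI))), S_INR. f_equal. ring. }
  intros k x. destruct (Z_le_gt_dec 0 k) as [Hk|Hk].
  - rewrite <- (Z2Nat.id k) by lia. rewrite <- INR_IZR_INZ. apply Hn.
  - rewrite <- (Hn (Z.to_nat (- k)) (x + _)). f_equal.
    rewrite INR_IZR_INZ, Z2Nat.id, opp_IZR by lia. ring.
Qed.

Lemma exists_periodic_representative a x :
  exists k y, a <= y <= a + 2 * PI /\ x = y + IZR k * (2 * PI).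
Proof.
  pose proof PI_RGT_0 as HPI.
  destruct (archimed ((x - a) / (2 * PI))) as [H1 H2].
  set (u := up ((x - a) / (2 * PI))) in *.
  exists (u - 1)%Z, (x - IZR (u - 1) * (2 * PI)).
  rewrite minus_IZR.
  assert (E : x - a = (x - a) / (2 * PI) * (2 * PI)) by (field; lra).
  split; [|ring]. split; nra.
Qed.

Lemma chi_bounded f : chi f -> exists M, 0 <= M /\ forall x, Rabs (f x) <= M.
Proof.
  intros [Pf Sf].
  pose proof PI_RGT_0 as HPI.
  destruct (continuity_ab_maj (fun x => Rabs (f x)) 0 (0 + 2 * PI)) as [m [Hm _]].
  { lra. }
  { intros c _. apply continuity_pt_filterlim.
    apply (continuous_comp f Rabs); [now apply smooth_continuous|].
    apply continuous_Rabs. }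
  exists (Rabs (f m)). split; [apply Rabs_pos|]. intros x.
  destruct (exists_periodic_representative 0 x) as (k & y & Hy & ->).
  rewrite periodic_IZR by assumption. now apply Hm.
Qed.

(** * The topology of uniform convergence of all derivatives *)

Definition CN_bound (N : nat) (f : R -> R) (M : R) : Prop :=
  forall n x, (n <= N)%nat -> Rabs (Derive_n f n x) <= M.

Lemma CN_bound_exists N f : chi f -> exists M, 0 <= M /\ CN_bound N f M.
Proof.
  intros Hf. induction N as [|N (M & HM & IH)].
  - destruct (chi_bounded f Hf) as (M & HM & H). exists M. split; [exact HM|].
    intros n x Hn. replace n with 0%nat by lia. apply H.
  - destruct (chi_bounded _ (chi_Derive_n f (S N) Hf)) as (M' & HM' & H).
    exists (M + M'). split; [lra|]. intros n x Hn.
    destruct (Nat.eq_dec n (S N)) as [->|Hne].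
    + specialize (H x). lra.
    + assert (Hle : (n <= N)%nat) by lia. specialize (IH n x Hle). lra.
Qed.

Lemma Derive_n_plus_fun f g n : smooth f -> smooth g ->
  Derive_n (fun x => f x + g x) n = (fun x => Derive_n f n x + Derive_n g n x).
Proof.
  intros Hf Hg. induction n as [|n IH]; [reflexivity|]. simpl. rewrite IH.
  apply Derive_plus_fun; now apply smooth_Derive_n.
Qed.

Lemma Derive_n_scal_fun c f n :
  Derive_n (fun x => c * f x) n = (fun x => c * Derive_n f n x).
Proof.
  induction n as [|n IH]; [reflexivity|]. simpl. rewrite IH. apply Derive_scal_fun.
Qed.

Lemma Derive_n_minus_fun f g n : smooth f -> smooth g ->
  Derive_n (fun x => f x - g x) n = (fun x => Derive_n f n x - Derive_n g n x).
Proof.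
  intros Hf Hg.
  replace (fun x => f x - g x) with (fun x => f x + -1 * g x)
    by (apply functional_extensionality; intros x; ring).
  rewrite Derive_n_plus_fun, Derive_n_scal_fun by auto using smooth_scal.
  apply functional_extensionality; intros x. ring.
Qed.

Lemma Derive_n_shift_fun t f n : smooth f ->
  Derive_n (fun x => f (x - t)) n = (fun x => Derive_n f n (x - t)).
Proof.
  intros Hf. induction n as [|n IH]; [reflexivity|]. simpl. rewrite IH.
  apply Derive_shift_fun. now apply smooth_Derive_n.
Qed.

Lemma CN_bound_plus N f g a b : smooth f -> smooth g ->
  CN_bound N f a -> CN_bound N g b -> CN_bound N (fun x => f x + g x) (a + b).
Proof.
  intros Sf Sg Hf Hg n x Hn. rewrite Derive_n_plus_fun by assumption.
  eapply Rle_trans; [apply Rabs_triang|].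
  specialize (Hf n x Hn). specialize (Hg n x Hn). lra.
Qed.

Lemma CN_bound_scal N c f a : CN_bound N f a ->
  CN_bound N (fun x => c * f x) (Rabs c * a).
Proof.
  intros Hf n x Hn. rewrite Derive_n_scal_fun, Rabs_mult.
  apply Rmult_le_compat_l; [apply Rabs_pos|]. now apply Hf.
Qed.

Lemma CN_bound_weaken N N' f a b : (N' <= N)%nat -> a <= b ->
  CN_bound N f a -> CN_bound N' f b.
Proof.
  intros HN Hab Hf n x Hn. eapply Rle_trans; [|exact Hab]. apply Hf. lia.
Qed.

Lemma CN_bound_Derive N f a : CN_bound (S N) f a -> CN_bound N (Derive f) a.
Proof. intros Hf n x Hn. rewrite Derive_n_Derive. apply Hf. lia. Qed.

(** The Leibniz rule doubles the number of terms at each differentiation. *)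
Lemma CN_bound_mult N f g a b : smooth f -> smooth g ->
  CN_bound N f a -> CN_bound N g b ->
  CN_bound N (fun x => f x * g x) (2 ^ N * (a * b)).
Proof.
  revert f g. induction N as [|N IH]; intros f g Sf Sg Hf Hg.
  - intros n x Hn. replace n with 0%nat by lia. simpl.
    rewrite Rabs_mult, Rmult_1_l.
    apply Rmult_le_compat; try apply Rabs_pos.
    + exact (Hf 0%nat x (le_n 0)).
    + exact (Hg 0%nat x (le_n 0)).
  - assert (Hf' := CN_bound_weaken _ N _ _ a (Nat.le_succ_diag_r N) (Rle_refl a) Hf).
    assert (Hg' := CN_bound_weaken _ N _ _ b (Nat.le_succ_diag_r N) (Rle_refl b) Hg).
    assert (E : 2 ^ S N * (a * b) = 2 ^ N * (a * b) + 2 ^ N * (a * b))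
      by (simpl; ring).
    intros n x Hn. destruct n as [|n].
    + assert (Ha : 0 <= a)
        by (eapply Rle_trans; [apply Rabs_pos|apply (Hf 0%nat x); lia]).
      assert (Hb : 0 <= b)
        by (eapply Rle_trans; [apply Rabs_pos|apply (Hg 0%nat x); lia]).
      assert (0 <= 2 ^ N * (a * b)).
      { apply Rmult_le_pos; [apply pow_le; lra|]. now apply Rmult_le_pos. }
      assert (H0 := IH f g Sf Sg Hf' Hg' 0%nat x (Nat.le_0_l N)). lra.
    + rewrite <- Derive_n_Derive, Derive_mult_fun, E by assumption.
      refine (CN_bound_plus N _ _ _ _ _ _ _ _ n x ltac:(lia));
        auto using smooth_mult, smooth_Derive, CN_bound_Derive.
Qed.

Definition Cinfty_closure (L : (R -> R) -> Prop) (w : R -> R) : Prop :=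
  chi w /\ forall N eps, 0 < eps ->
  exists u, L u /\ CN_bound N (fun x => u x - w x) eps.

Lemma Cinfty_closure_incl L u : lie_subalgebra L -> L u -> Cinfty_closure L u.
Proof.
  intros HL Hu. split; [now apply (lie_chi _ HL)|].
  intros N eps Heps. exists u. split; [exact Hu|].
  intros n x _. replace (fun x => u x - u x) with (fun x => 0 * u x)
    by (apply functional_extensionality; intros y; ring).
  rewrite Derive_n_scal_fun, Rmult_0_l, Rabs_R0. lra.
Qed.

Lemma Cinfty_closure_closed L w : lie_subalgebra L -> chi w ->
  (forall N eps, 0 < eps ->
    exists p, Cinfty_closure L p /\ CN_bound N (fun x => p x - w x) eps) ->
  Cinfty_closure L w.
Proof.
  intros HL Hw H. split; [exact Hw|]. intros N eps Heps.
  destruct (H N (eps / 2)) as (p & [Cp Hp] & Hpw); [lra|].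
  destruct (Hp N (eps / 2)) as (u & Lu & Hup); [lra|].
  exists u. split; [exact Lu|].
  assert (Cu := lie_chi _ HL _ Lu).
  replace (fun x => u x - w x) with (fun x => (u x - p x) + (p x - w x))
    by (apply functional_extensionality; intros y; ring).
  replace eps with (eps / 2 + eps / 2) by field.
  apply CN_bound_plus; try assumption; now apply chi_minus.
Qed.

Lemma Cinfty_closure_dense L :
  lie_subalgebra L -> (forall w, chi w -> Cinfty_closure L w) -> Cinfty_dense L.
Proof.
  intros HL H w Hw N eps Heps.
  destruct (proj2 (H w Hw) N (eps / 2)) as (u & Lu & Hu); [lra|].
  exists u. split; [exact Lu|]. intros n x Hn.
  assert (Cu := lie_chi _ HL _ Lu). specialize (Hu n x Hn).
  rewrite Derive_n_minus_fun in Hu by (apply Cu || apply Hw). lra.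
Qed.

Lemma Cinfty_closure_add L f g : lie_subalgebra L ->
  Cinfty_closure L f -> Cinfty_closure L g -> Cinfty_closure L (fun x => f x + g x).
Proof.
  intros HL [Cf Hf] [Cg Hg]. split; [now apply chi_plus|]. intros N eps Heps.
  destruct (Hf N (eps / 2)) as (u & Lu & Hu); [lra|].
  destruct (Hg N (eps / 2)) as (w & Lw & Hw); [lra|].
  exists (fun x => u x + w x). split; [now apply (lie_add _ HL)|].
  assert (Cu := lie_chi _ HL _ Lu). assert (Cw := lie_chi _ HL _ Lw).
  replace (fun x => u x + w x - (f x + g x)) with
    (fun x => (u x - f x) + (w x - g x))
    by (apply functional_extensionality; intros y; ring).
  replace eps with (eps / 2 + eps / 2) by field.
  apply CN_bound_plus; try assumption; now apply chi_minus.
Qed.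

Lemma Cinfty_closure_scal L c f : lie_subalgebra L ->
  Cinfty_closure L f -> Cinfty_closure L (fun x => c * f x).
Proof.
  intros HL [Cf Hf]. split; [now apply chi_scal|]. intros N eps Heps.
  assert (Hc := Rabs_pos c).
  destruct (Hf N (eps / (Rabs c + 1))) as (u & Lu & Hu).
  { apply Rdiv_lt_0_compat; lra. }
  exists (fun x => c * u x). split; [now apply (lie_scal _ HL)|].
  replace (fun x => c * u x - c * f x) with (fun x => c * (u x - f x))
    by (apply functional_extensionality; intros y; ring).
  eapply CN_bound_weaken; [apply le_n| |apply CN_bound_scal, Hu].
  assert (E : eps = (Rabs c + 1) * (eps / (Rabs c + 1))) by (field; lra).
  assert (0 < eps / (Rabs c + 1)) by (apply Rdiv_lt_0_compat; lra).
  nra.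
Qed.

(** Both terms of the bracket are products, so by the Leibniz rule its
    derivatives of order at most [N] are controlled by those of the factors of
    order at most [N + 1]. *)
Lemma CN_bound_bracket N f g a b : smooth f -> smooth g ->
  CN_bound (S N) f a -> CN_bound (S N) g b ->
  CN_bound N (bracket f g) (2 ^ S N * (a * b)).
Proof.
  intros Sf Sg Hf Hg.
  assert (Hf' := CN_bound_weaken _ N _ _ a (Nat.le_succ_diag_r N) (Rle_refl a) Hf).
  assert (Hg' := CN_bound_weaken _ N _ _ b (Nat.le_succ_diag_r N) (Rle_refl b) Hg).
  replace (bracket f g) with
    (fun x => f x * Derive g x + -1 * (g x * Derive f x))
    by (apply functional_extensionality; intros y; unfold bracket; ring).
  replace (2 ^ S N * (a * b))
    with (2 ^ N * (a * b) + Rabs (-1) * (2 ^ N * (b * a)))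
    by (rewrite (Rabs_left (-1)) by lra; simpl; ring).
  apply CN_bound_plus; auto using smooth_mult, smooth_scal, smooth_Derive.
  - apply CN_bound_mult; auto using smooth_Derive, CN_bound_Derive.
  - apply CN_bound_scal, CN_bound_mult; auto using smooth_Derive, CN_bound_Derive.
Qed.

(** Expanding the perturbed bracket bilinearly leaves three brackets that each
    have a small argument. *)
Lemma bracket_minus f f0 g g0 : smooth f -> smooth f0 -> smooth g -> smooth g0 ->
  (fun x => bracket f g x - bracket f0 g0 x) =
  (fun x => (bracket (fun y => f y - f0 y) (fun y => g y - g0 y) x +
             bracket (fun y => f y - f0 y) g0 x) +
             bracket f0 (fun y => g y - g0 y) x).
Proof.
  intros Hf Hf0 Hg Hg0. apply functional_extensionality; intros x. unfold bracket.
  rewrite !Derive_minus by now apply smooth_ex_derive. ring.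
Qed.

Lemma Cinfty_closure_bracket L f g : lie_subalgebra L ->
  Cinfty_closure L f -> Cinfty_closure L g -> Cinfty_closure L (bracket f g).
Proof.
  intros HL [Cf Hf] [Cg Hg]. split; [now apply chi_bracket|]. intros N eps Heps.
  destruct (CN_bound_exists (S N) f Cf) as (A & HA & BA).
  destruct (CN_bound_exists (S N) g Cg) as (B & HB & BB).
  set (P := 2 ^ S N). assert (HP : 0 < P) by (apply pow_lt; lra).
  set (M := P * (1 + A + B)).
  assert (HM : 0 < M) by (apply Rmult_lt_0_compat; lra).
  (* with d <= 1 the three errors add up to at most P * d * (d + B + A) <= M * d *)
  set (d := Rmin 1 (eps / M)).
  assert (Hd : 0 < d).
  { apply Rmin_glb_lt; [lra|]. now apply Rdiv_lt_0_compat. }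
  assert (Hd1 : d <= 1) by apply Rmin_l.
  assert (Hd2 : M * d <= eps).
  { replace eps with (M * (eps / M)) by (field; lra).
    apply Rmult_le_compat_l; [lra|apply Rmin_r]. }
  destruct (Hf (S N) d Hd) as (u & Lu & Hu).
  destruct (Hg (S N) d Hd) as (w & Lw & Hw).
  assert (Cu := lie_chi _ HL _ Lu). assert (Cw := lie_chi _ HL _ Lw).
  exists (bracket u w). split; [now apply (lie_bracket _ HL)|].
  rewrite bracket_minus by (apply Cu || apply Cw || apply Cf || apply Cg).
  set (df := fun y => u y - f y) in *. set (dg := fun y => w y - g y) in *.
  assert (Cdf : chi df) by now apply chi_minus.
  assert (Cdg : chi dg) by now apply chi_minus.
  eapply CN_bound_weaken; [apply le_n| |].
  2: { apply CN_bound_plus; [| |apply CN_bound_plus|].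
    - apply chi_plus; now apply chi_bracket.
    - now apply chi_bracket.
    - now apply chi_bracket.
    - now apply chi_bracket.
    - apply CN_bound_bracket; [apply Cdf|apply Cdg|exact Hu|exact Hw].
    - apply CN_bound_bracket; [apply Cdf|apply Cg|exact Hu|exact BB].
    - apply CN_bound_bracket; [apply Cf|apply Cdg|exact BA|exact Hw]. }
  fold P. unfold M in Hd2. nra.
Qed.

Lemma lie_subalgebra_Cinfty_closure L :
  lie_subalgebra L -> lie_subalgebra (Cinfty_closure L).
Proof.
  intros HL. split.
  - now intros u [Cu _].
  - apply Cinfty_closure_incl; [exact HL|apply (lie_zero _ HL)].
  - intros u w. now apply Cinfty_closure_add.
  - intros c u. now apply Cinfty_closure_scal.
  - intros u w. now apply Cinfty_closure_bracket.
Qed.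

(** * Trigonometric polynomials and convolution *)

Definition wave (a b : R) (k : Z) : R -> R :=
  fun x => a * cos (IZR k * x) + b * sin (IZR k * x).

Inductive trig_poly : (R -> R) -> Prop :=
| tp_wave a b k : trig_poly (wave a b k)
| tp_add f g : trig_poly f -> trig_poly g -> trig_poly (fun x => f x + g x).

Lemma is_derive_wave a b k x :
  is_derive (wave a b k) x (wave (IZR k * b) (- IZR k * a) k x).
Proof. unfold wave. auto_derive; [exact I|ring]. Qed.

Lemma Derive_wave a b k : Derive (wave a b k) = wave (IZR k * b) (- IZR k * a) k.
Proof.
  apply functional_extensionality; intros x. apply is_derive_unique, is_derive_wave.
Qed.

Lemma cos_sin_periodic_IZR k x :
  cos (x + IZR k * (2 * PI)) = cos x /\ sin (x + IZR k * (2 * PI)) = sin x.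
Proof.
  split.
  - apply (periodic_IZR cos). intros y. rewrite cos_plus, cos_2PI, sin_2PI; ring.
  - apply (periodic_IZR sin). intros y. rewrite sin_plus, cos_2PI, sin_2PI; ring.
Qed.

Lemma chi_wave a b k : chi (wave a b k).
Proof.
  split.
  - intros x. unfold wave.
    replace (IZR k * (x + 2 * PI)) with (IZR k * x + IZR k * (2 * PI)) by ring.
    now destruct (cos_sin_periodic_IZR k (IZR k * x)) as [-> ->].
  - apply (smooth_of_derive_stable (fun f => exists a b k, f = wave a b k)); [|eauto].
    clear. intros f (a & b & k & ->). split.
    + intros x. eexists. apply is_derive_wave.
    + rewrite Derive_wave. eauto.
Qed.

Lemma chi_trig_poly f : trig_poly f -> chi f.
Proof. intros H. induction H; auto using chi_wave, chi_plus. Qed.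

Lemma trig_poly_scal c f : trig_poly f -> trig_poly (fun x => c * f x).
Proof.
  intros H. induction H as [a b k|f g _ IHf _ IHg].
  - replace (fun x => c * wave a b k x) with (wave (c * a) (c * b) k);
      [constructor|].
    apply functional_extensionality; intros x. unfold wave. ring.
  - replace (fun x => c * (f x + g x)) with (fun x => c * f x + c * g x);
      [now constructor|].
    apply functional_extensionality; intros x. ring.
Qed.

Lemma trig_poly_mult_cos f : trig_poly f -> trig_poly (fun x => f x * cos x).
Proof.
  intros H. induction H as [a b k|f g _ IHf _ IHg].
  - replace (fun x => wave a b k x * cos x) with
      (fun x => wave (a / 2) (b / 2) (k + 1) x + wave (a / 2) (b / 2) (k - 1) x);
      [repeat constructor|].
    apply functional_extensionality; intros x. unfold wave.
    rewrite plus_IZR, minus_IZR.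
    replace ((IZR k + 1) * x) with (IZR k * x + x) by ring.
    replace ((IZR k - 1) * x) with (IZR k * x - x) by ring.
    rewrite cos_plus, cos_minus, sin_plus, sin_minus. field.
  - replace (fun x => (f x + g x) * cos x) with (fun x => f x * cos x + g x * cos x);
      [now constructor|].
    apply functional_extensionality; intros x. ring.
Qed.

Lemma ex_RInt_chi f a b : chi f -> ex_RInt f a b.
Proof.
  intros [_ Sf]. apply (@ex_RInt_continuous R_CompleteNormedModule).
  intros z _. now apply smooth_continuous.
Qed.

(** Integrals have their values in the carrier of a normed module, which hides
    the field structure of [R] from [ring] and [field]. *)
Ltac real_equation := match goal with |- ?a = ?b => change (@eq R a b) end.

Lemma RInt_ext_fun (f g : R -> R) a b :
  (forall x, f x = g x) -> RInt f a b = RInt g a b.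
Proof. intros H. now rewrite (functional_extensionality f g H). Qed.

Lemma RInt_plus_chi f g a b : chi f -> chi g ->
  RInt (fun x => f x + g x) a b = RInt f a b + RInt g a b.
Proof. intros. apply (@RInt_plus R_CompleteNormedModule); now apply ex_RInt_chi. Qed.

Lemma RInt_scal_chi c f a b : chi f ->
  RInt (fun x => c * f x) a b = c * RInt f a b.
Proof. intros. apply (@RInt_scal R_CompleteNormedModule). now apply ex_RInt_chi. Qed.

Lemma RInt_Chasles_chi f a b c : chi f ->
  RInt f a b + RInt f b c = RInt f a c.
Proof.
  intros. apply (@RInt_Chasles R_CompleteNormedModule); now apply ex_RInt_chi.
Qed.

Lemma RInt_period f a : chi f -> RInt f a (a + 2 * PI) = RInt f 0 (2 * PI).
Proof.
  intros Cf.
  assert (E : RInt f (2 * PI) (a + 2 * PI) = RInt f 0 a).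
  { replace (2 * PI) with (1 * 0 + 2 * PI) at 1 by ring.
    replace (a + 2 * PI) with (1 * a + 2 * PI) by ring.
    rewrite <- (@RInt_comp_lin R_CompleteNormedModule) by now apply ex_RInt_chi.
    apply RInt_ext_fun. intros x. rewrite <- (proj1 Cf x).
    unfold scal; simpl; unfold mult; simpl. rewrite !Rmult_1_l. reflexivity. }
  assert (E1 := RInt_Chasles_chi f 0 a (a + 2 * PI) Cf).
  assert (E2 := RInt_Chasles_chi f 0 (2 * PI) (a + 2 * PI) Cf).
  lra.
Qed.

Lemma RInt_Derive_period f : chi f -> RInt (Derive f) 0 (2 * PI) = 0.
Proof.
  intros Cf.
  assert (H : is_RInt (Derive f) 0 (2 * PI) (minus (f (2 * PI)) (f 0))).
  { apply (is_RInt_derive f); intros x _.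
    - apply smooth_is_derive, Cf.
    - apply smooth_continuous, smooth_Derive, Cf. }
  rewrite (is_RInt_unique _ _ _ _ H).
  rewrite <- (proj1 Cf 0), Rplus_0_l. apply Rminus_diag.
Qed.

Lemma RInt_by_parts_period f g : chi f -> chi g ->
  RInt (fun x => f x * Derive g x) 0 (2 * PI) =
  -1 * RInt (fun x => Derive f x * g x) 0 (2 * PI).
Proof.
  intros Cf Cg.
  assert (H := RInt_Derive_period _ (chi_mult f g Cf Cg)).
  rewrite Derive_mult_fun in H by (apply Cf || apply Cg).
  rewrite RInt_plus_chi in H by auto using chi_mult, chi_Derive.
  lra.
Qed.

Definition cos_coeff (w : R -> R) (k : Z) : R :=
  RInt (fun s => wave 1 0 k s * w s) 0 (2 * PI).

Definition sin_coeff (w : R -> R) (k : Z) : R :=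
  RInt (fun s => wave 0 1 k s * w s) 0 (2 * PI).

Lemma cos_coeff_Derive w k : chi w ->
  cos_coeff (Derive w) k = IZR k * sin_coeff w k.
Proof.
  intros Cw. unfold cos_coeff, sin_coeff.
  rewrite RInt_by_parts_period, Derive_wave by auto using chi_wave.
  rewrite <- !RInt_scal_chi by auto using chi_mult, chi_wave.
  apply RInt_ext_fun. intros x. unfold wave. ring.
Qed.

Lemma sin_coeff_Derive w k : chi w ->
  sin_coeff (Derive w) k = - IZR k * cos_coeff w k.
Proof.
  intros Cw. unfold cos_coeff, sin_coeff.
  rewrite RInt_by_parts_period, Derive_wave by auto using chi_wave.
  rewrite <- !RInt_scal_chi by auto using chi_mult, chi_wave.
  apply RInt_ext_fun. intros x. unfold wave. ring.
Qed.

Definition convolution (K w : R -> R) : R -> R :=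
  fun x => RInt (fun s => K (x - s) * w s) 0 (2 * PI).

Lemma chi_reflect_shift x f : chi f -> chi (fun s => f (x - s)).
Proof.
  intros [Pf Sf]. split.
  - intros s. rewrite <- Pf. f_equal. ring.
  - apply (smooth_of_derive_stable
      (fun h => exists f, smooth f /\ h = fun s => f (x - s))); [|eauto].
    clear. intros h (f & Sf & ->).
    assert (D : forall s, is_derive (fun s => f (x - s)) s (-1 * Derive f (x - s))).
    { intros s. auto_derive; [now apply smooth_ex_derive|].
      unfold Rminus. apply f_equal2; [ring|]. reflexivity. }
    split.
    + intros s. eexists. apply D.
    + exists (fun y => -1 * Derive f y).
      split; [now apply smooth_scal, smooth_Derive|].
      apply functional_extensionality; intros s. apply is_derive_unique, D.
Qed.

Lemma convolution_wave a b k w : chi w ->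
  convolution (wave a b k) w =
  wave (a * cos_coeff w k - b * sin_coeff w k)
       (a * sin_coeff w k + b * cos_coeff w k) k.
Proof.
  intros Cw. apply functional_extensionality; intros x. unfold convolution.
  replace (fun s => wave a b k (x - s) * w s) with
    (fun s => wave a b k x * (wave 1 0 k s * w s)
              + wave (- b) a k x * (wave 0 1 k s * w s)).
  - rewrite RInt_plus_chi, !RInt_scal_chi
      by auto using chi_scal, chi_mult, chi_wave.
    unfold cos_coeff, sin_coeff, wave. ring.
  - apply functional_extensionality; intros s. unfold wave.
    replace (IZR k * (x - s)) with (IZR k * x - IZR k * s) by ring.
    rewrite cos_minus, sin_minus. ring.
Qed.

Lemma convolution_plus f g w : chi f -> chi g -> chi w ->
  convolution (fun x => f x + g x) w = (fun x => convolution f w x + convolution g w x).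
Proof.
  intros Cf Cg Cw. apply functional_extensionality; intros x. unfold convolution.
  rewrite <- RInt_plus_chi by auto using chi_mult, chi_reflect_shift.
  apply RInt_ext_fun. intros s. ring.
Qed.

Lemma trig_poly_convolution K w : trig_poly K -> chi w -> trig_poly (convolution K w).
Proof.
  intros HK Cw. induction HK as [a b k|f g Hf IHf Hg IHg].
  - rewrite convolution_wave by assumption. constructor.
  - rewrite convolution_plus by auto using chi_trig_poly. now constructor.
Qed.

(** On a wave this is the rule by which differentiation multiplies Fourier
    coefficients, so no differentiation under the integral is involved. *)
Lemma Derive_convolution K w : trig_poly K -> chi w ->
  Derive (convolution K w) = convolution K (Derive w).
Proof.
  intros HK Cw. induction HK as [a b k|f g Hf IHf Hg IHg].
  - rewrite !convolution_wave, Derive_wave by auto using chi_Derive.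
    rewrite cos_coeff_Derive, sin_coeff_Derive by assumption.
    f_equal; ring.
  - rewrite !convolution_plus by auto using chi_trig_poly, chi_Derive.
    rewrite Derive_plus_fun, IHf, IHg; [reflexivity| |];
      now apply chi_trig_poly, trig_poly_convolution.
Qed.

Lemma Derive_n_convolution K w n : trig_poly K -> chi w ->
  Derive_n (convolution K w) n = convolution K (Derive_n w n).
Proof.
  intros HK Cw. induction n as [|n IH]; [reflexivity|].
  simpl. rewrite IH. apply Derive_convolution; auto using chi_Derive_n.
Qed.

(** The substitution [s = x - t] moves the interval of integration, which
    periodicity moves back. *)
Lemma convolution_sym K w a x : chi K -> chi w ->
  convolution K w x = RInt (fun t => K t * w (x - t)) a (a + 2 * PI).
Proof.
  intros CK Cw. unfold convolution.
  assert (CF : chi (fun s => K (x - s) * w s))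
    by auto using chi_mult, chi_reflect_shift.
  rewrite <- (RInt_period _ (x - a - 2 * PI) CF).
  assert (E : RInt (fun t => -1 * (K t * w (x - t))) a (a + 2 * PI) =
              RInt (fun s => K (x - s) * w s) (x - a) (x - a - 2 * PI)).
  { replace (x - a) with (-1 * a + x) at 1 by ring.
    replace (x - a - 2 * PI) with (-1 * (a + 2 * PI) + x) by ring.
    rewrite <- (@RInt_comp_lin R_CompleteNormedModule) by now apply ex_RInt_chi.
    apply RInt_ext_fun. intros t.
    unfold scal; simpl; unfold mult; simpl.
    replace (x - (-1 * t + x)) with t by ring.
    now replace (-1 * t + x) with (x - t) by ring. }
  rewrite RInt_scal_chi in E by auto using chi_mult, chi_reflect_shift.
  assert (E2 := RInt_Chasles_chi _ (x - a) (x - a - 2 * PI) (x - a) CF).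
  rewrite (@RInt_point R_CompleteNormedModule) in E2.
  replace (x - a - 2 * PI + 2 * PI) with (x - a) by ring.
  change (zero : R) with 0 in E2. lra.
Qed.

(** * Averaging over rotations *)

Fixpoint riemann_sum (F : R -> R) (h : R) (m : nat) : R :=
  match m with
  | O => 0
  | S m => riemann_sum F h m + h * F (INR m * h)
  end.

(** On an interval of length [h] the integrand differs from its left value by at
    most [M h]. *)
Lemma riemann_sum_error F M h m : smooth F -> 0 <= h ->
  (forall t, Rabs (Derive F t) <= M) ->
  Rabs (riemann_sum F h m - RInt F 0 (INR m * h)) <= INR m * (M * h ^ 2).
Proof.
  intros SF Hh HM.
  assert (ex : forall a b, ex_RInt F a b).
  { intros a b. apply (@ex_RInt_continuous R_CompleteNormedModule).
    intros z _. now apply smooth_continuous. }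
  induction m as [|m IH].
  - simpl. rewrite !Rmult_0_l, RInt_point. change (zero : R) with 0.
    rewrite Rminus_0_r, Rabs_R0. lra.
  - rewrite S_INR. simpl riemann_sum. set (a := INR m * h) in *.
    replace ((INR m + 1) * h) with (a + h) by (unfold a; ring).
    rewrite <- (@RInt_Chasles R_CompleteNormedModule F 0 a (a + h)) by apply ex.
    change plus with Rplus.
    assert (E : RInt (fun t => F t - F a) a (a + h) = RInt F a (a + h) - h * F a).
    { rewrite (@RInt_minus R_CompleteNormedModule F (fun _ => F a))
        by (apply ex || apply ex_RInt_const).
      rewrite RInt_const. unfold minus, plus, opp, scal; simpl.
      unfold mult; simpl. ring. }
    assert (B : Rabs (RInt (fun t => F t - F a) a (a + h)) <= (a + h - a) * (M * h)).
    { apply abs_RInt_le_const; [lra| |].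
      - apply (@ex_RInt_minus R_NormedModule F (fun _ => F a));
          (apply ex || apply ex_RInt_const).
      - intros t Ht.
        destruct (MVT_gen F a t (Derive F)) as (c & _ & ->).
        + intros y _. now apply smooth_is_derive.
        + intros y _. apply continuity_pt_filterlim. now apply smooth_continuous.
        + rewrite Rabs_mult. apply Rmult_le_compat; try apply Rabs_pos; [apply HM|].
          rewrite Rabs_pos_eq; lra. }
    rewrite E in B. revert IH B.
    set (u := riemann_sum F h m). set (p := RInt F 0 a). set (q := RInt F a (a + h)).
    intros IH B.
    replace (u + h * F a - (p + q)) with ((u - p) - (q - h * F a)) by ring.
    eapply Rle_trans; [apply Rabs_triang|]. rewrite Rabs_Ropp. lra.
Qed.

Lemma riemann_sum_smooth (c : R -> R) w h m : smooth w ->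
  smooth (fun x => riemann_sum (fun t => c t * w (x - t)) h m).
Proof.
  intros Sw. induction m as [|m IH]; simpl; [apply smooth_const|].
  apply smooth_plus; [exact IH|].
  now apply smooth_scal, smooth_scal, smooth_shift.
Qed.

Lemma Derive_n_riemann_sum (c : R -> R) w h m n : smooth w ->
  Derive_n (fun x => riemann_sum (fun t => c t * w (x - t)) h m) n =
  (fun x => riemann_sum (fun t => c t * Derive_n w n (x - t)) h m).
Proof.
  intros Sw. induction m as [|m IH]; simpl.
  - apply functional_extensionality; intros x.
    destruct n; [reflexivity|]. apply Derive_n_const.
  - rewrite Derive_n_plus_fun, IH, 2!Derive_n_scal_fun, Derive_n_shift_fun;
      [reflexivity|assumption|now apply riemann_sum_smooth|].
    now apply smooth_scal, smooth_scal, smooth_shift.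
Qed.

Lemma riemann_sum_mem L (c : R -> R) w h m : lie_subalgebra L ->
  (forall t, L (fun x => w (x - t))) ->
  L (fun x => riemann_sum (fun t => c t * w (x - t)) h m).
Proof.
  intros HL Hw. induction m as [|m IH]; simpl; [apply (lie_zero _ HL)|].
  apply (lie_add _ HL); [exact IH|].
  apply (lie_scal _ HL), (lie_scal _ HL), Hw.
Qed.

Lemma Derive_mult_reflect_bound (c w : R -> R) A B x t : smooth c -> smooth w ->
  CN_bound 1 c A -> CN_bound 1 w B ->
  Rabs (Derive (fun t => c t * w (x - t)) t) <= A * B + A * B.
Proof.
  intros Sc Sw Hc Hw.
  assert (E : Derive (fun t => c t * w (x - t)) t =
              Derive c t * w (x - t) + - (c t * Derive w (x - t))).
  { apply is_derive_unique. auto_derive.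
    - split; [now apply smooth_ex_derive|].
      split; [now apply smooth_ex_derive|exact I].
    - replace (x + - t) with (x - t) by ring.
      change (Derive (fun x => c x)) with (Derive c).
      change (Derive (fun x => w x)) with (Derive w). ring. }
  rewrite E. eapply Rle_trans; [apply Rabs_triang|].
  rewrite Rabs_Ropp, !Rabs_mult.
  apply Rplus_le_compat; (apply Rmult_le_compat; try apply Rabs_pos).
  - exact (Hc 1%nat t (le_n 1)).
  - apply (Hw 0%nat); lia.
  - apply (Hc 0%nat); lia.
  - exact (Hw 1%nat _ (le_n 1)).
Qed.

(** The convolution is a limit of Riemann sums, which are linear combinations of
    rotates of [w].  Differentiating a Riemann sum only replaces [w] by its
    derivatives, so the error estimate applies to each derivative. *)
Lemma convolution_in_closure L K w : lie_subalgebra L -> trig_poly K -> chi w ->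
  (forall t, L (rotate t w)) -> Cinfty_closure L (convolution K w).
Proof.
  intros HL HK Cw Hrot.
  assert (CK := chi_trig_poly K HK).
  split; [now apply chi_trig_poly, trig_poly_convolution|].
  intros N eps Heps.
  destruct (CN_bound_exists 1 K CK) as (A & HA & BA).
  destruct (CN_bound_exists (S N) w Cw) as (B & HB & BB).
  pose proof PI_RGT_0 as HPI.
  set (M := A * B + A * B).
  assert (HM : 0 <= M) by (unfold M; nra).
  destruct (nfloor_ex (M * (2 * PI) ^ 2 / eps)) as (m & _ & Hm).
  { apply Rdiv_le_0_compat; [nra|lra]. }
  rewrite <- S_INR in Hm.
  assert (Hm0 : 0 < INR (S m)) by (apply lt_0_INR; lia).
  set (h := 2 * PI / INR (S m)).
  assert (Eh : INR (S m) * h = 2 * PI) by (unfold h; field; lra).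
  assert (Hh : 0 <= h) by (apply Rdiv_le_0_compat; lra).
  exists (fun x => riemann_sum (fun t => K t * w (x - t)) h (S m)).
  split; [now apply riemann_sum_mem|].
  intros n x Hn.
  rewrite Derive_n_minus_fun, Derive_n_riemann_sum, Derive_n_convolution;
    try assumption; try apply Cw.
  2: { apply (riemann_sum_smooth K w h (S m)), Cw. }
  2: { now apply chi_trig_poly, trig_poly_convolution. }
  rewrite (convolution_sym K _ 0), Rplus_0_l, <- Eh by auto using chi_Derive_n.
  eapply Rle_trans.
  - apply (riemann_sum_error _ M); [|exact Hh|].
    + apply chi_mult; [exact CK|]. now apply chi_reflect_shift, chi_Derive_n.
    + intros t. apply Derive_mult_reflect_bound; try assumption; try apply CK.
      * now apply chi_Derive_n.
      * intros i y Hi. rewrite Derive_n_comp. apply BB. lia.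
  - replace (INR (S m) * (M * h ^ 2)) with (M * (2 * PI) ^ 2 / INR (S m))
      by (rewrite <- Eh; field; lra).
    apply Rle_div_l; [lra|]. apply Rlt_le. 
    apply Rlt_div_l in Hm; lra.
Qed.

(** Averaging [v'] against [cos k x] isolates its [k]-th harmonic, and the
    bracket with [d/dx] turns that wave by a quarter period. *)
Lemma waves_of_harmonic L v k : lie_subalgebra L -> chi v -> L d_dx ->
  (forall t, L (rotate t (Derive v))) ->
  IZR k <> 0 -> cos_coeff v k <> 0 \/ sin_coeff v k <> 0 ->
  forall a b, Cinfty_closure L (wave a b k).
Proof.
  intros HL Cv Hd Hrot Hk Hne a b.
  assert (HC := lie_subalgebra_Cinfty_closure L HL).
  assert (H1 := convolution_in_closure L (wave 1 0 k) (Derive v) HL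
                  (tp_wave _ _ _) (chi_Derive _ Cv) Hrot).
  rewrite convolution_wave, cos_coeff_Derive, sin_coeff_Derive in H1
    by auto using chi_Derive.
  set (A := cos_coeff v k) in *. set (B := sin_coeff v k) in *.
  set (q := IZR k) in *.
  assert (H2 := lie_bracket _ HC _ _ (Cinfty_closure_incl L _ HL Hd) H1).
  rewrite bracket_d_dx, Derive_wave in H2. fold q in H2.
  set (s := q ^ 2 * (A ^ 2 + B ^ 2)).
  assert (Hs : s <> 0).
  { unfold s. apply Rmult_integral_contrapositive_currified.
    - now apply pow_nonzero.
    - destruct Hne as [H|H]; apply pow_nonzero with (n := 2%nat) in H;
        assert (0 <= A ^ 2) by apply pow2_ge_0;
        assert (0 <= B ^ 2) by apply pow2_ge_0; lra. }
  (* the two waves are orthogonal with squared amplitudes s and q^2 * s *)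
  set (c1 := (a * (q * B) - b * (q * A)) / s).
  set (c2 := - (a * A + b * B) / s).
  assert (H3 := lie_add _ HC _ _ (lie_scal _ HC c1 _ H1) (lie_scal _ HC c2 _ H2)).
  refine (eq_ind _ (Cinfty_closure L) H3 _ _).
  apply functional_extensionality; intros x. unfold wave, c1, c2, s.
  fold q. field. 
  split; [|exact Hk]. intros E. apply Hs. unfold s. rewrite E. ring.
Qed.

(** * The harmonics of a Lie algebra *)

(** The real form of the bracket [i (q - p) e^(i (p + q) x)] of [e^(i p x)] and
    [e^(i q x)]. *)
Lemma wave_add_frequencies L p q : lie_subalgebra L -> p <> q ->
  (forall a b, L (wave a b p)) -> (forall a b, L (wave a b q)) ->
  forall a b, L (wave a b (p + q)).
Proof.
  intros HL Hpq Hp Hq a b.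
  assert (Hne : IZR p - IZR q <> 0).
  { intros E. apply Hpq, eq_IZR. lra. }
  set (S := fun x => bracket (wave 1 0 p) (wave 1 0 q) x
                     + -1 * bracket (wave 0 1 p) (wave 0 1 q) x).
  set (T := fun x => bracket (wave 0 1 p) (wave 1 0 q) x
                     + bracket (wave 1 0 p) (wave 0 1 q) x).
  assert (HS : L S).
  { apply (lie_add _ HL); [|apply (lie_scal _ HL)]; apply (lie_bracket _ HL);
      auto. }
  assert (HT : L T) by (apply (lie_add _ HL); apply (lie_bracket _ HL); auto).
  (* S and T are the sine and cosine of (p + q) x, scaled by p - q and q - p *)
  assert (H := lie_add _ HL _ _
    (lie_scal _ HL (b / (IZR p - IZR q)) _ HS)
    (lie_scal _ HL (- a / (IZR p - IZR q)) _ HT)).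
  refine (eq_ind _ L H _ _).
  apply functional_extensionality; intros x. unfold S, T, bracket.
  rewrite !Derive_wave. unfold wave. rewrite plus_IZR.
  replace ((IZR p + IZR q) * x) with (IZR p * x + IZR q * x) by ring.
  rewrite cos_plus, sin_plus. field. exact Hne.
Qed.

(** The partial sums [r + s], [(r + s) + r] and [((r + s) + r) - s] only add
    distinct elements. *)
Lemma double_of_distinct_sums (K : Z -> Prop) :
  (forall k, K k -> K (- k)%Z) ->
  (forall p q, K p -> K q -> p <> q -> K (p + q)%Z) ->
  forall r s, K r -> K s -> s <> 0%Z -> s <> r -> s <> (- r)%Z -> K (2 * r)%Z.
Proof.
  intros Hopp Hadd r s Hr Hs H0 H1 H2.
  assert (A : K (r + s)%Z) by (apply Hadd; auto; lia).
  assert (B : K (r + s + r)%Z) by (apply Hadd; auto; lia).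
  replace (2 * r)%Z with (r + s + r + - s)%Z by ring.
  apply Hadd; auto; lia.
Qed.

(** Two elements of different absolute value make every doubling available, so
    the sum of distinct elements is all that is missing for a subgroup. *)
Lemma subgroup_of_distinct_sums (K : Z -> Prop) p q :
  (forall k, K k -> K (- k)%Z) ->
  (forall p q, K p -> K q -> p <> q -> K (p + q)%Z) ->
  K 0%Z -> K p -> K q -> p <> 0%Z -> q <> 0%Z -> p <> q -> p <> (- q)%Z ->
  forall r s, K r -> K s -> K (r + s)%Z.
Proof.
  intros Hopp Hadd K0 Kp Kq Hp Hq Hpq Hpq' r s Kr Ks.
  destruct (Z.eq_dec r s) as [<-|Hne]; [|now apply Hadd].
  replace (r + r)%Z with (2 * r)%Z by ring.
  destruct (Z.eq_dec p r) as [E|E1]; [|destruct (Z.eq_dec p (- r)) as [E|E2]].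
  - apply (double_of_distinct_sums K Hopp Hadd r q); auto; lia.
  - apply (double_of_distinct_sums K Hopp Hadd r q); auto; lia.
  - apply (double_of_distinct_sums K Hopp Hadd r p); auto; lia.
Qed.

Lemma subgroup_mult (K : Z -> Prop) :
  K 0%Z -> (forall k, K k -> K (- k)%Z) ->
  (forall p q, K p -> K q -> K (p + q)%Z) ->
  forall n k, K k -> K (n * k)%Z.
Proof.
  intros K0 Hopp Hadd n k Kk.
  assert (H : forall m, (0 <= m)%Z -> K (m * k)%Z).
  { apply natlike_ind; [exact K0|]. intros m _ IH.
    rewrite Z.mul_succ_l. now apply Hadd. }
  destruct (Z_le_gt_dec 0 n) as [Hn|Hn]; [now apply H|].
  replace (n * k)%Z with (- (- n * k))%Z by ring. apply Hopp, H. lia.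
Qed.

(** Division by the least positive element leaves a remainder in the subgroup
    that is smaller, hence zero. *)
Lemma subgroup_principal (K : Z -> Prop) :
  K 0%Z -> (forall k, K k -> K (- k)%Z) ->
  (forall p q, K p -> K q -> K (p + q)%Z) ->
  forall n, K n -> (0 < n)%Z ->
  exists d, (0 < d)%Z /\ K d /\ forall k, K k -> (d | k)%Z.
Proof.
  intros K0 Hopp Hadd n Kn Hn.
  assert (Hle : (0 <= n)%Z) by lia. revert n Hle Kn Hn.
  refine (Z_lt_induction _ _). intros n IH Kn Hn.
  destruct (classic (exists m, K m /\ (0 < m < n)%Z)) as [(m & Km & Hm)|Hmin].
  - apply (IH m); (assumption || lia).
  - exists n. split; [exact Hn|]. split; [exact Kn|]. intros k Kk.
    assert (Hr : K (k mod n)%Z).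
    { replace (k mod n)%Z with (k + - (k / n) * n)%Z
        by (pose proof (Z.div_mod k n ltac:(lia)); lia).
      apply Hadd; [exact Kk|]. now apply subgroup_mult. }
    apply Z.mod_divide; [lia|].
    pose proof (Z.mod_pos_bound k n Hn).
    destruct (Z.eq_dec (k mod n) 0) as [E|E]; [exact E|].
    exfalso. apply Hmin. exists (k mod n)%Z. split; [exact Hr|lia].
Qed.

Lemma subgroup_gcd_one (S K : Z -> Prop) : is_gcd_of S 1 ->
  (forall k, S k -> K k) ->
  K 0%Z -> (forall k, K k -> K (- k)%Z) ->
  (forall p q, K p -> K q -> K (p + q)%Z) ->
  forall k, K k.
Proof.
  intros (_ & _ & Hgcd) HSK K0 Hopp Hadd.
  assert (Hpos : exists n, K n /\ (0 < n)%Z).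
  { apply NNPP. intros Hno.
    assert (H2 : (2 | 1)%Z).
    { apply Hgcd. intros k Sk. exists 0%Z.
      destruct (Z_dec' k 0) as [[Hk|Hk]|Hk]; [| |lia]; exfalso; apply Hno;
        [exists (- k)%Z|exists k]; (split; [auto|lia]). }
    destruct H2 as [z Hz]. lia. }
  destruct Hpos as (n & Kn & Hn).
  destruct (subgroup_principal K K0 Hopp Hadd n Kn Hn) as (d & Hd & Kd & Hdiv).
  assert (E : d = 1%Z).
  { apply Z.divide_1_r_nonneg; [lia|]. apply Hgcd. auto. }
  subst d. intros k. rewrite <- (Z.mul_1_r k). now apply subgroup_mult.
Qed.

(** * Density of trigonometric polynomials *)

(** A nonnegative kernel that peaks at 0; multiplying it by [1 + cos x] gives the
    next one, so a recursion for the mass also controls its concentration. *)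
Definition bump (n : nat) : R -> R := fun x => (1 + cos x) ^ n.

Lemma trig_poly_bump n : trig_poly (bump n).
Proof.
  induction n as [|n IH].
  - replace (bump 0) with (wave 1 0 0); [constructor|].
    apply functional_extensionality; intros x. unfold bump, wave. simpl.
    rewrite !Rmult_0_l, cos_0. ring.
  - replace (bump (S n)) with (fun x => bump n x + bump n x * cos x);
      [now constructor; [|apply trig_poly_mult_cos]|].
    apply functional_extensionality; intros x. unfold bump. simpl. ring.
Qed.

Definition bump_mass (n : nat) : R := RInt (bump n) (- PI) (- PI + 2 * PI).

(** The function [sin x * (1 + cos x)^n] has derivative
    [(n + 1) (1 + cos x)^(n+1) - (2 n + 1) (1 + cos x)^n] and is periodic. *)
Lemma bump_mass_succ n :
  INR (S n) * bump_mass (S n) = (2 * INR n + 1) * bump_mass n.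
Proof.
  assert (Cb : forall m, chi (bump m)) by (intros; apply chi_trig_poly, trig_poly_bump).
  assert (Cs : chi sin).
  { replace sin with (wave 0 1 1); [apply chi_wave|].
    apply functional_extensionality; intros x. unfold wave. rewrite !Rmult_1_l. ring. }
  assert (E : Derive (fun x => sin x * bump n x) =
    (fun x => INR (S n) * bump (S n) x + - (2 * INR n + 1) * bump n x)).
  { apply functional_extensionality; intros x. apply is_derive_unique.
    unfold bump. auto_derive; [exact I|]. rewrite S_INR.
    destruct n as [|n]; [simpl; ring|]. simpl pred. rewrite <- !tech_pow_Rmult.
    transitivity ((1 + cos x) ^ n *
      (cos x * (1 + cos x) - INR (S n) * (sin x)²)); [unfold Rsqr; ring|].
    rewrite sin2. unfold Rsqr. ring. }
  assert (H := RInt_Derive_period _ (chi_mult _ _ Cs (Cb n))).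
  rewrite E, RInt_plus_chi, !RInt_scal_chi in H by auto using chi_scal.
  unfold bump_mass. rewrite !RInt_period by apply Cb. lra.
Qed.

Lemma bump_mass_pos n : 0 < bump_mass n.
Proof.
  induction n as [|n IH].
  - unfold bump_mass. rewrite (RInt_ext_fun _ (fun _ => 1)) by reflexivity.
    rewrite RInt_const. unfold scal; simpl; unfold mult; simpl.
    pose proof PI_RGT_0. lra.
  - assert (H := bump_mass_succ n). assert (Hn := pos_INR n). rewrite S_INR in H.
    apply Rmult_lt_reg_l with (INR n + 1); nra.
Qed.

Definition approx_identity (n : nat) : R -> R := fun x => / bump_mass n * bump n x.

Lemma trig_poly_approx_identity n : trig_poly (approx_identity n).
Proof. apply trig_poly_scal, trig_poly_bump. Qed.

Lemma approx_identity_nonneg n x : 0 <= approx_identity n x.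
Proof.
  apply Rmult_le_pos.
  - apply Rlt_le, Rinv_0_lt_compat, bump_mass_pos.
  - apply pow_le. pose proof (COS_bound x). lra.
Qed.

Lemma RInt_approx_identity n : RInt (approx_identity n) (- PI) (- PI + 2 * PI) = 1.
Proof.
  unfold approx_identity.
  rewrite RInt_scal_chi by apply chi_trig_poly, trig_poly_bump.
  apply Rinv_l. pose proof (bump_mass_pos n). unfold bump_mass in *. lra.
Qed.

(** As [1 - cos t] is comparable to [t^2], this decay says that the mass
    concentrates at the origin. *)
Lemma RInt_approx_identity_cos n :
  RInt (fun t => approx_identity n t * (1 - cos t)) (- PI) (- PI + 2 * PI)
  = / (INR n + 1).
Proof.
  rewrite (RInt_ext_fun _
    (fun t => / bump_mass n * (2 * bump n t + -1 * bump (S n) t))).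
  2: { intros t. unfold approx_identity, bump. simpl. ring. }
  assert (Cb : forall m, chi (bump m)) by (intros; apply chi_trig_poly, trig_poly_bump).
  rewrite RInt_scal_chi, RInt_plus_chi, !RInt_scal_chi
    by auto using chi_plus, chi_scal.
  fold (bump_mass n) (bump_mass (S n)).
  assert (H := bump_mass_succ n). rewrite S_INR in H.
  assert (Hp := bump_mass_pos n). assert (Hn := pos_INR n).
  replace (bump_mass (S n)) with ((2 * INR n + 1) * bump_mass n / (INR n + 1))
    by (rewrite <- H; field; lra).
  real_equation. field. lra.
Qed.

(** The linear term is at most [e] near the origin, and [1 - cos t] is bounded
    below away from it. *)
Lemma linear_le_one_minus_cos M e : 0 <= M -> 0 < e ->
  exists c, 0 <= c /\
    forall t, - PI <= t <= PI -> M * Rabs t <= e + c * (1 - cos t).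
Proof.
  intros HM He. pose proof PI_RGT_0 as HPI.
  set (d := Rmin PI (e / (M + 1))).
  assert (Hd : 0 < d) by (apply Rmin_glb_lt; [lra|apply Rdiv_lt_0_compat; lra]).
  assert (HdPI : d <= PI) by apply Rmin_l.
  assert (Hd2 : M * d <= e).
  { assert (Hq : d <= e / (M + 1)) by apply Rmin_r.
    assert (E : e = (M + 1) * (e / (M + 1))) by (field; lra). nra. }
  assert (Hcos : 0 < 1 - cos d).
  { pose proof (cos_decreasing_1 0 d). rewrite cos_0 in *. lra. }
  exists (M * PI / (1 - cos d)).
  assert (Hc : 0 <= M * PI / (1 - cos d)) by (apply Rdiv_le_0_compat; nra).
  split; [exact Hc|]. intros t Ht.
  assert (Ec : cos t = cos (Rabs t)).
  { unfold Rabs. destruct Rcase_abs; [now rewrite cos_neg|reflexivity]. }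
  assert (Hat : 0 <= Rabs t <= PI).
  { split; [apply Rabs_pos|]. apply Rabs_le. lra. }
  rewrite Ec. generalize dependent (Rabs t). intros u _ Hu.
  destruct (Rle_lt_dec u d) as [Hud|Hud].
  - pose proof (COS_bound u). nra.
  - assert (H1 : cos u <= cos d) by (apply cos_decr_1; lra).
    assert (E : M * PI = M * PI / (1 - cos d) * (1 - cos d)) by (field; lra).
    nra.
Qed.

Lemma lipschitz_of_Derive_bound f M x t : smooth f ->
  (forall y, Rabs (Derive f y) <= M) -> Rabs (f (x - t) - f x) <= M * Rabs t.
Proof.
  intros Sf HM.
  destruct (MVT_gen f x (x - t) (Derive f)) as (c & _ & ->).
  - intros y _. now apply smooth_is_derive.
  - intros y _. apply continuity_pt_filterlim. now apply smooth_continuous.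
  - rewrite Rabs_mult. replace (x - t - x) with (- t) by ring. rewrite Rabs_Ropp.
    apply Rmult_le_compat_r; [apply Rabs_pos|apply HM].
Qed.

(** Convolution commutes with differentiation, so a single convolution with a
    trigonometric polynomial approximates [w] together with its derivatives. *)
Lemma approx_identity_converges w N eps : chi w -> 0 < eps ->
  exists n, CN_bound N (fun x => convolution (approx_identity n) w x - w x) eps.
Proof.
  intros Cw Heps. pose proof PI_RGT_0 as HPI.
  destruct (CN_bound_exists (S N) w Cw) as (M & HM & BM).
  destruct (linear_le_one_minus_cos M (eps / 2) HM) as (c & Hc & Hlin); [lra|].
  destruct (nfloor_ex (c / (eps / 2))) as (n & _ & Hn).
  { apply Rdiv_le_0_compat; lra. }
  apply Rlt_div_l in Hn; [|lra].
  exists n. intros i x Hi.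
  assert (HK := trig_poly_approx_identity n). assert (CK := chi_trig_poly _ HK).
  set (K := approx_identity n) in *.
  rewrite Derive_n_minus_fun, Derive_n_convolution;
    try assumption; [|now apply chi_trig_poly, trig_poly_convolution|apply Cw].
  assert (Ci := chi_Derive_n w i Cw). set (f := Derive_n w i) in *.
  rewrite (convolution_sym K f (- PI)) by assumption.
  assert (E : RInt (fun t => K t * (f (x - t) - f x)) (- PI) (- PI + 2 * PI) =
              RInt (fun t => K t * f (x - t)) (- PI) (- PI + 2 * PI) - f x).
  { rewrite (RInt_ext_fun _ (fun t => K t * f (x - t) + - f x * K t))
      by (intros t; ring).
    rewrite RInt_plus_chi, RInt_scal_chi
      by auto using chi_scal, chi_mult, chi_reflect_shift.
    unfold K at 2. rewrite RInt_approx_identity. real_equation. ring. }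
  rewrite <- E.
  set (g := fun t => eps / 2 * K t + c * (K t * (1 - cos t))).
  assert (Cg' : chi (fun t => K t * (1 - cos t))).
  { apply chi_mult; [exact CK|]. apply chi_minus; [apply chi_const|].
    replace cos with (wave 1 0 1); [apply chi_wave|].
    apply functional_extensionality; intros y. unfold wave. rewrite !Rmult_1_l. ring. }
  assert (Cg : chi g) by (unfold g; auto using chi_plus, chi_scal).
  assert (Ig : RInt g (- PI) (- PI + 2 * PI) = eps / 2 + c * / (INR n + 1)).
  { unfold g. rewrite RInt_plus_chi, !RInt_scal_chi by auto using chi_scal.
    unfold K. rewrite RInt_approx_identity, RInt_approx_identity_cos. real_equation. ring. }
  assert (Hle : Rabs (RInt (fun t => K t * (f (x - t) - f x)) (- PI) (- PI + 2 * PI))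
                <= RInt g (- PI) (- PI + 2 * PI)).
  { apply (norm_RInt_le (V := R_NormedModule)
      (fun t => K t * (f (x - t) - f x)) g (- PI) (- PI + 2 * PI)); [lra| | |].
    - intros t Ht. change (norm (K t * (f (x - t) - f x)))
        with (Rabs (K t * (f (x - t) - f x))).
      assert (H0 := approx_identity_nonneg n t). fold K in H0.
      rewrite Rabs_mult, (Rabs_pos_eq (K t)) by exact H0.
      assert (HL : Rabs (f (x - t) - f x) <= M * Rabs t).
      { apply lipschitz_of_Derive_bound; [apply Ci|].
        intros y. apply (BM (S i)). lia. }
      assert (Hlin' := Hlin t ltac:(lra)). unfold g. nra.
    - apply (@RInt_correct R_CompleteNormedModule), ex_RInt_chi.
      apply chi_mult; [exact CK|].
      apply chi_minus; [now apply chi_reflect_shift|apply chi_const].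
    - apply (@RInt_correct R_CompleteNormedModule). now apply ex_RInt_chi. }
  rewrite Ig in Hle.
  assert (Hn0 := pos_INR n).
  assert (c * / (INR n + 1) <= eps / 2) by (apply Rle_div_l; lra).
  lra.
Qed.

(** * Fourier coefficients and the two cases *)

Lemma harmonic_iff v k : chi v ->
  harmonic v k <-> k <> 0%Z /\ (cos_coeff v k <> 0 \/ sin_coeff v k <> 0).
Proof.
  intros Cv. unfold harmonic.
  assert (E : fourier_coeff v k =
    (/ (2 * PI) * cos_coeff v k, - / (2 * PI) * sin_coeff v k)).
  { unfold fourier_coeff.
    assert (H : is_RInt (V := C_R_NormedModule)
      (fun x => (RtoC (v x) * cis (- (IZR k * x)))%C) 0 (2 * PI)
      (cos_coeff v k, -1 * sin_coeff v k)).
    { apply (is_RInt_fct_extend_pair (U := R_NormedModule) (V := R_NormedModule)).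
      - apply (is_RInt_ext (fun x => wave 1 0 k x * v x)).
        + intros x _. unfold wave. simpl. rewrite cos_neg, sin_neg. ring.
        + apply (@RInt_correct R_CompleteNormedModule), ex_RInt_chi.
          auto using chi_mult, chi_wave.
      - apply (is_RInt_ext (fun x => -1 * (wave 0 1 k x * v x))).
        + intros x _. unfold wave. simpl. rewrite cos_neg, sin_neg. ring.
        + unfold sin_coeff. rewrite <- RInt_scal_chi by auto using chi_mult, chi_wave.
          apply (@RInt_correct R_CompleteNormedModule), ex_RInt_chi.
          auto using chi_mult, chi_wave, chi_scal. }
    apply (@is_RInt_unique C_R_CompleteNormedModule) in H. rewrite H.
    unfold Cmult. simpl. f_equal; ring. }
  rewrite E. pose proof PI_RGT_0 as HPI.
  assert (HI : / (2 * PI) <> 0) by (apply Rinv_neq_0_compat; lra).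
  split; intros [Hk H]; (split; [exact Hk|]).
  - apply NNPP. intros Hn. apply H. apply not_or_and in Hn. destruct Hn as [H1 H2].
    apply NNPP in H1. apply NNPP in H2. rewrite H1, H2. unfold RtoC.
    f_equal; ring.
  - intros Ep. injection Ep as E1 E2.
    apply Rmult_integral in E1. rewrite Ropp_mult_distr_l_reverse in E2.
    apply Ropp_eq_0_compat in E2. rewrite Ropp_involutive in E2.
    apply Rmult_integral in E2. tauto.
Qed.

Lemma lie_subalgebra_chi : lie_subalgebra chi.
Proof. split; auto using chi_const, chi_plus, chi_scal, chi_bracket. Qed.

Lemma lie_subalgebra_Lambda v : chi v -> lie_subalgebra (Lambda v).
Proof.
  intros Cv. split.
  - intros u Hu. apply (Hu chi lie_subalgebra_chi).
    intros w [->|[->|[t ->]]]; [apply chi_const| |apply chi_shift];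
      rewrite bracket_d_dx; now apply chi_Derive.
  - intros L HL _. apply (lie_zero _ HL).
  - intros u w Hu Hw L HL HS. apply (lie_add _ HL); [now apply Hu|now apply Hw].
  - intros c u Hu L HL HS. apply (lie_scal _ HL). now apply Hu.
  - intros u w Hu Hw L HL HS. apply (lie_bracket _ HL); [now apply Hu|now apply Hw].
Qed.

Lemma Lambda_d_dx v : Lambda v d_dx.
Proof. intros L _ HS. apply HS. now left. Qed.

Lemma Lambda_rotate v t : Lambda v (rotate t (Derive v)).
Proof. intros L _ HS. apply HS. right; right. exists t. now rewrite bracket_d_dx. Qed.

(** The frequencies whose waves lie in the closure form a subgroup of [Z] that
    contains all harmonics, hence all of [Z]. *)
Lemma Lambda_dense v k0 : chi v -> coprime_harmonics v ->
  harmonic v k0 -> k0 <> 1%Z -> k0 <> (-1)%Z -> Cinfty_dense (Lambda v).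
Proof.
  intros Cv Hgcd Hk0 Hn1 Hn2.
  assert (HL := lie_subalgebra_Lambda v Cv).
  assert (HC := lie_subalgebra_Cinfty_closure _ HL).
  set (K := fun k => forall a b, Cinfty_closure (Lambda v) (wave a b k)).
  assert (HK : forall k, harmonic v k -> K k).
  { intros k Hk. apply harmonic_iff in Hk; [|exact Cv]. destruct Hk as [Hk Hne].
    unfold K. apply (waves_of_harmonic _ v); auto using Lambda_d_dx, Lambda_rotate.
    intros E. now apply Hk, eq_IZR. }
  assert (K0 : K 0%Z).
  { intros a b. replace (wave a b 0) with (fun x => a * d_dx x).
    - apply (lie_scal _ HC), Cinfty_closure_incl; [exact HL|apply Lambda_d_dx].
    - apply functional_extensionality; intros x. unfold wave, d_dx.
      rewrite !Rmult_0_l, cos_0, sin_0. ring. }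
  assert (Kopp : forall k, K k -> K (- k)%Z).
  { intros k Kk a b. replace (wave a b (- k)) with (wave a (- b) k); [apply Kk|].
    apply functional_extensionality; intros x. unfold wave.
    rewrite opp_IZR. replace (- IZR k * x) with (- (IZR k * x)) by ring.
    rewrite cos_neg, sin_neg. ring. }
  assert (Kdist : forall p q, K p -> K q -> p <> q -> K (p + q)%Z).
  { intros p q Kp Kq Hpq. unfold K. now apply wave_add_frequencies. }
  (* k0 cannot divide all harmonics, since it is not +-1 *)
  assert (Hk1 : exists k1, harmonic v k1 /\ k1 <> k0 /\ k1 <> (- k0)%Z).
  { apply NNPP. intros Hno.
    assert (Hd : (k0 | 1)%Z).
    { apply Hgcd. intros k Hk.
      destruct (Z.eq_dec k k0) as [->|E1]; [apply Z.divide_refl|].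
      destruct (Z.eq_dec k (- k0)) as [->|E2]; [exists (-1)%Z; ring|].
      exfalso. apply Hno. now exists k. }
    apply Z.divide_1_r in Hd. lia. }
  destruct Hk1 as (k1 & Hk1 & H1 & H2).
  assert (Kall : forall k, K k).
  { apply (subgroup_gcd_one _ K Hgcd HK K0 Kopp).
    apply (subgroup_of_distinct_sums K k1 k0); auto; try apply Hk1; try apply Hk0. }
  apply Cinfty_closure_dense; [exact HL|]. intros w Cw.
  apply Cinfty_closure_closed; [exact HL|exact Cw|]. intros N eps Heps.
  destruct (approx_identity_converges w N eps Cw Heps) as [n Hn].
  eexists. split; [|exact Hn].
  assert (HT := trig_poly_convolution _ w (trig_poly_approx_identity n) Cw).
  revert HT. generalize (convolution (approx_identity n) w). intros p HT.
  induction HT as [a b k|f g _ IHf _ IHg]; [apply Kall|].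
  now apply (lie_add _ HC).
Qed.

(** * The span of 1, cos and sin *)

Definition first_harmonic (u : R -> R) : Prop :=
  exists a b c, forall x, u x = a * sin x + b * cos x + c.

(** Such a function is determined by its values at three points; in this form
    the condition passes to pointwise limits. *)
Definition three_point_interpolation (u : R -> R) (x : R) : R :=
  (u 0 + u PI) / 2 + (u 0 - u PI) / 2 * cos x
  + (u (PI / 2) - (u 0 + u PI) / 2) * sin x.

Lemma first_harmonic_iff u :
  first_harmonic u <-> forall x, u x = three_point_interpolation u x.
Proof.
  split.
  - intros (a & b & c & H) x. unfold three_point_interpolation. rewrite !H.
    rewrite sin_0, cos_0, sin_PI, cos_PI, sin_PI2, cos_PI2. field.
  - intros H. unfold three_point_interpolation in H.
    exists (u (PI / 2) - (u 0 + u PI) / 2), ((u 0 - u PI) / 2), ((u 0 + u PI) / 2).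
    intros x. rewrite H at 1. ring.
Qed.

Lemma first_harmonic_closed u :
  (forall eps, 0 < eps ->
    exists p, first_harmonic p /\ forall x, Rabs (p x - u x) <= eps) ->
  first_harmonic u.
Proof.
  intros H. apply first_harmonic_iff. intros x.
  apply cond_eq. intros eps Heps.
  destruct (H (eps / 6)) as (p & Hp & Hpu); [lra|].
  apply first_harmonic_iff with (x := x) in Hp.
  assert (Hmul : forall e c d, Rabs e <= d -> Rabs c <= 1 -> Rabs (e * c) <= d).
  { intros e c d He Hc. rewrite Rabs_mult. pose proof (Rabs_pos e). nra. }
  assert (Hc : Rabs (cos x) <= 1) by (apply Rabs_le, COS_bound).
  assert (Hs : Rabs (sin x) <= 1) by (apply Rabs_le, SIN_bound).
  set (e0 := p 0 - u 0). set (e1 := p PI - u PI).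
  set (e2 := p (PI / 2) - u (PI / 2)). set (ex := p x - u x).
  assert (H0 : Rabs e0 <= eps / 6) by apply Hpu.
  assert (H1 : Rabs e1 <= eps / 6) by apply Hpu.
  assert (H2 : Rabs e2 <= eps / 6) by apply Hpu.
  assert (Hx : Rabs ex <= eps / 6) by apply Hpu.
  replace (u x - three_point_interpolation u x) with
    ((e0 + e1) / 2 + (e0 - e1) / 2 * cos x + (e2 - (e0 + e1) / 2) * sin x - ex)
    by (unfold three_point_interpolation in *; unfold e0, e1, e2, ex;
        rewrite Hp; field).
  apply Rabs_le_between in H0, H1, H2, Hx.
  assert (B0 : Rabs ((e0 + e1) / 2) <= eps / 6) by (apply Rabs_le; lra).
  assert (B1 : Rabs ((e0 - e1) / 2 * cos x) <= eps / 6)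
    by (apply Hmul; [apply Rabs_le; lra|exact Hc]).
  assert (B2 : Rabs ((e2 - (e0 + e1) / 2) * sin x) <= 2 * (eps / 6))
    by (apply Hmul; [apply Rabs_le; lra|exact Hs]).
  apply Rabs_le_between in B0, B1, B2.
  apply Rabs_def1; lra.
Qed.

Lemma first_harmonic_wave a b k : k = 0%Z \/ k = 1%Z \/ k = (-1)%Z ->
  first_harmonic (wave a b k).
Proof.
  unfold wave. intros [-> | [-> | ->]].
  - exists 0, 0, a. intros x. rewrite !Rmult_0_l, cos_0, sin_0. ring.
  - exists b, a, 0. intros x. rewrite !Rmult_1_l. ring.
  - exists (- b), a, 0. intros x.
    replace (IZR (-1) * x) with (- x) by ring. rewrite cos_neg, sin_neg. ring.
Qed.

Lemma first_harmonic_plus f g : first_harmonic f -> first_harmonic g ->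
  first_harmonic (fun x => f x + g x).
Proof.
  intros (a & b & c & Hf) (a' & b' & c' & Hg). exists (a + a'), (b + b'), (c + c').
  intros x. rewrite Hf, Hg. ring.
Qed.

(** Convolution with a trigonometric polynomial keeps only harmonics of the
    field, so the approximants stay in the three-dimensional space. *)
Lemma first_harmonic_of_harmonics v : chi v ->
  (forall k, harmonic v k -> k = 1%Z \/ k = (-1)%Z) -> first_harmonic v.
Proof.
  intros Cv Hk. apply first_harmonic_closed. intros eps Heps.
  destruct (approx_identity_converges v 0 eps Cv Heps) as [n Hn].
  exists (convolution (approx_identity n) v).
  split; [|intros x; exact (Hn 0%nat x (le_n 0))].
  clear Hn. assert (HT := trig_poly_approx_identity n).
  revert HT. generalize (approx_identity n). intros K HT.
  induction HT as [a b k|f g Hf IHf Hg IHg].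
  - rewrite convolution_wave by exact Cv.
    destruct (classic (harmonic v k)) as [H|H].
    + apply first_harmonic_wave. specialize (Hk k H). tauto.
    + rewrite harmonic_iff in H by exact Cv.
      destruct (Z.eq_dec k 0) as [E|E]; [apply first_harmonic_wave; tauto|].
      assert (H1 : cos_coeff v k = 0) by (apply NNPP; tauto).
      assert (H2 : sin_coeff v k = 0) by (apply NNPP; tauto).
      rewrite H1, H2. exists 0, 0, 0. intros x. unfold wave. ring.
  - rewrite convolution_plus by auto using chi_trig_poly.
    now apply first_harmonic_plus.
Qed.

Lemma first_harmonic_eq_wave u : first_harmonic u ->
  exists a b c, u = (fun x => wave a b 1 x + wave c 0 0 x).
Proof.
  intros (a & b & c & H). exists b, a, c. apply functional_extensionality; intros x.
  rewrite H. unfold wave. rewrite !Rmult_1_l, !Rmult_0_l, cos_0. ring.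
Qed.

Lemma chi_first_harmonic u : first_harmonic u -> chi u.
Proof.
  intros H. destruct (first_harmonic_eq_wave u H) as (a & b & c & ->).
  apply chi_plus; apply chi_wave.
Qed.

Lemma Derive_first_harmonic u a b c : (forall x, u x = a * sin x + b * cos x + c) ->
  Derive u = wave a (- b) 1.
Proof.
  intros H. apply functional_extensionality; intros x. apply is_derive_unique.
  apply (is_derive_ext (fun x => a * sin x + b * cos x + c)); [now intros|].
  unfold wave. auto_derive; [exact I|]. rewrite !Rmult_1_l. ring.
Qed.

Lemma lie_subalgebra_first_harmonic : lie_subalgebra first_harmonic.
Proof.
  split.
  - apply chi_first_harmonic.
  - exists 0, 0, 0. intros x. ring.
  - apply first_harmonic_plus.
  - intros k u (a & b & c & H). exists (k * a), (k * b), (k * c).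
    intros x. rewrite H. ring.
  - intros u w (a & b & c & Hu) (a' & b' & c' & Hw).
    exists (b' * - c + c' * b), (a' * c - c' * a), (a' * b - b' * a).
    intros x. unfold bracket.
    rewrite (Derive_first_harmonic _ _ _ _ Hu), (Derive_first_harmonic _ _ _ _ Hw).
    rewrite Hu, Hw. unfold wave. rewrite !Rmult_1_l.
    pose proof (sin2_cos2 x) as E. unfold Rsqr in E.
    transitivity ((b' * - c + c' * b) * sin x + (a' * c - c' * a) * cos x
       + (a' * b - b' * a) * (sin x * sin x + cos x * cos x)); [ring|rewrite E; ring].
Qed.

Lemma Lambda_incl_first_harmonic v u :
  first_harmonic v -> Lambda v u -> first_harmonic u.
Proof.
  intros (a & b & c & Hv) Hu. apply (Hu _ lie_subalgebra_first_harmonic).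
  intros w. rewrite bracket_d_dx, (Derive_first_harmonic _ _ _ _ Hv).
  intros [->|[->|[t ->]]].
  - exists 0, 0, 1. intros x. unfold d_dx. ring.
  - apply first_harmonic_wave. tauto.
  - exists (a * sin t - b * cos t), (a * cos t + b * sin t), 0. intros x.
    unfold rotate, wave. rewrite !Rmult_1_l, cos_minus, sin_minus. ring.
Qed.

(** The derivative vanishes, and its [k]-th coefficients are those of the field
    multiplied by [k] or [-k]. *)
Lemma not_harmonic_const v k : chi v -> (exists c, forall x, v x = c) -> ~ harmonic v k.
Proof.
  intros Cv [c Hc] H. apply harmonic_iff in H; [|exact Cv]. destruct H as [Hk H].
  assert (E : Derive v = fun _ => 0).
  { apply functional_extensionality; intros x.
    rewrite (Derive_ext _ (fun _ => c)) by exact Hc. apply Derive_const. }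
  assert (H1 := cos_coeff_Derive v k Cv). assert (H2 := sin_coeff_Derive v k Cv).
  assert (Z1 : forall f : R -> R, RInt (fun s => f s * 0) 0 (2 * PI) = 0).
  { intros f. rewrite (RInt_ext_fun _ (fun _ => 0)) by (intros; ring).
    rewrite RInt_const. apply Rmult_0_r. }
  rewrite E in H1, H2. unfold cos_coeff at 1 in H1. unfold sin_coeff at 1 in H2.
  rewrite Z1 in H1, H2.
  assert (Hk' : IZR k <> 0) by (intros E'; now apply Hk, eq_IZR).
  destruct H as [H|H]; apply (Rmult_integral_contrapositive_currified _ _ Hk') in H;
    lra.
Qed.

Lemma Lambda_eq_first_harmonic v : chi v -> coprime_harmonics v -> first_harmonic v ->
  forall u, Lambda v u <-> first_harmonic u.
Proof.
  intros Cv Hgcd Hv u. split; [now apply Lambda_incl_first_harmonic|]. intros Hu.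
  assert (HL := lie_subalgebra_Lambda v Cv).
  destruct Hv as (a & b & c & Hv).
  assert (Hab : a * a + b * b <> 0).
  { intros E. assert (Ea : a = 0) by nra. assert (Eb : b = 0) by nra.
    destruct Hgcd as (_ & _ & Hgcd).
    assert (H2 : (2 | 1)%Z).
    { apply Hgcd. intros k Hk. exfalso. apply (not_harmonic_const v k Cv); [|exact Hk].
      exists c. intros x. rewrite Hv, Ea, Eb. ring. }
    destruct H2 as [z Hz]. lia. }
  assert (H1 : Lambda v (wave a (- b) 1)).
  { rewrite <- (Derive_first_harmonic _ _ _ _ Hv).
    intros L _ HS. apply HS. right; left. now rewrite bracket_d_dx. }
  assert (H2 := lie_bracket _ HL _ _ (Lambda_d_dx v) H1).
  rewrite bracket_d_dx, Derive_wave in H2.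
  destruct Hu as (p & q & r & Hu).
  set (s := a * a + b * b) in *.
  assert (H3 := lie_add _ HL _ _
    (lie_add _ HL _ _ (lie_scal _ HL ((a * q - b * p) / s) _ H1)
                      (lie_scal _ HL (- (a * p + b * q) / s) _ H2))
    (lie_scal _ HL r _ (Lambda_d_dx v))).
  refine (eq_ind _ (Lambda v) H3 _ _).
  apply functional_extensionality; intros x. rewrite Hu. unfold wave, d_dx, s.
  rewrite !Rmult_1_l. field. exact Hab.
Qed.

(** The span is closed, and [cos 2x] does not lie in it: it takes the value 1 at
    0 and pi and -1 at +-pi/2. *)
Lemma first_harmonic_not_dense L :
  (forall u, L u -> first_harmonic u) -> ~ Cinfty_dense L.
Proof.
  intros HL Hd.
  assert (H : first_harmonic (wave 1 0 2)).
  { apply first_harmonic_closed. intros eps Heps.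
    destruct (Hd (wave 1 0 2) (chi_wave _ _ _) 0%nat eps Heps) as (u & Lu & Hu).
    exists u. split; [now apply HL|]. intros x. apply Rlt_le.
    exact (Hu 0%nat x (le_n 0)). }
  assert (E := proj1 (first_harmonic_iff _) H (- (PI / 2))).
  unfold three_point_interpolation, wave in E.
  rewrite cos_neg, sin_neg, cos_PI2, sin_PI2 in E.
  replace (2 * 0) with 0 in E by ring.
  replace (2 * (PI / 2)) with PI in E by field.
  replace (2 * - (PI / 2)) with (- PI) in E by field.
  rewrite cos_neg, cos_0, cos_PI, cos_2PI in E. lra.
Qed.

(** * One-parameter groups of Moebius transformations *)

Notation is_derive_C := (is_derive (K := R_AbsRing) (V := C_R_NormedModule)).

Lemma is_derive_C_iff (f : R -> C) t (l : C) :
  is_derive_C f t l <->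
  is_derive (fun s => fst (f s)) t (fst l) /\ is_derive (fun s => snd (f s)) t (snd l).
Proof.
  split.
  - intros H. split.
    + apply (filterdiff_ext_lin (fun s => fst (f s)) (fun y => fst (scal y l : C_R_NormedModule)));
        [|reflexivity].
      apply (filterdiff_comp' f (fst : C_R_NormedModule -> R_NormedModule) t _ fst H).
      apply (filterdiff_linear fst), (is_linear_fst (U := R_NormedModule) (V := R_NormedModule)).
    + apply (filterdiff_ext_lin (fun s => snd (f s)) (fun y => snd (scal y l : C_R_NormedModule)));
        [|reflexivity].
      apply (filterdiff_comp' f (snd : C_R_NormedModule -> R_NormedModule) t _ snd H).
      apply (filterdiff_linear snd), (is_linear_snd (U := R_NormedModule) (V := R_NormedModule)).
  - intros [H1 H2].
    assert (E : forall z : C, z = plus (scal (fst z) (1, 0) : C_R_NormedModule)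
                                       (scal (snd z) (0, 1) : C_R_NormedModule)).
    { intros [x y]. unfold plus, scal; simpl. unfold prod_plus, prod_scal, scal, plus; simpl.
      unfold mult; simpl. f_equal; ring. }
    rewrite (E l). eapply is_derive_ext; [intros s; symmetry; apply E|].
    apply (is_derive_plus (K := R_AbsRing) (V := C_R_NormedModule)).
    + now apply (is_derive_scal_l (K := R_AbsRing) (V := C_R_NormedModule)).
    + now apply (is_derive_scal_l (K := R_AbsRing) (V := C_R_NormedModule)).
Qed.

Lemma is_derive_C_unique f t l l' :
  is_derive_C f t l -> is_derive_C f t l' -> l = l'.
Proof.
  rewrite !is_derive_C_iff. intros [H1 H2] [H3 H4].
  apply is_derive_unique in H1, H2, H3, H4.
  destruct l, l'; simpl in *. congruence.
Qed.

Lemma is_derive_C_minus f g t l m : is_derive_C f t l -> is_derive_C g t m ->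
  is_derive_C (fun s => f s - g s)%C t (l - m)%C.
Proof. intros. now apply (is_derive_minus (K := R_AbsRing) (V := C_R_NormedModule)). Qed.

Lemma is_derive_C_mult f g t l m : is_derive_C f t l -> is_derive_C g t m ->
  is_derive_C (fun s => f s * g s)%C t (l * g t + f t * m)%C.
Proof.
  rewrite !is_derive_C_iff. intros [F1 F2] [G1 G2].
  assert (M : forall f g t l m, is_derive f t l -> is_derive g t m ->
    is_derive (fun s => f s * g s) t (l * g t + f t * m)).
  { intros f0 g0 t0 l0 m0 H1 H2. exact (is_derive_mult f0 g0 t0 l0 m0 H1 H2 Rmult_comm). }
  split.
  - assert (H := is_derive_minus _ _ _ _ _ (M _ _ _ _ _ F1 G1) (M _ _ _ _ _ F2 G2)).
    refine (eq_ind _ (fun y => is_derive (fun s => fst (f s * g s)%C) t y) H _ _).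
    unfold minus, plus, opp; simpl. ring.
  - assert (H := is_derive_plus _ _ _ _ _ (M _ _ _ _ _ F1 G2) (M _ _ _ _ _ F2 G1)).
    refine (eq_ind _ (fun y => is_derive (fun s => snd (f s * g s)%C) t y) H _ _).
    unfold plus; simpl. ring.
Qed.

Lemma is_derive_C_plus f g t l m : is_derive_C f t l -> is_derive_C g t m ->
  is_derive_C (fun s => f s + g s)%C t (l + m)%C.
Proof. intros. now apply (is_derive_plus (K := R_AbsRing) (V := C_R_NormedModule)). Qed.

Lemma is_derive_C_const (z : C) t : is_derive_C (fun _ => z) t (RtoC 0).
Proof. apply (is_derive_const (K := R_AbsRing) (V := C_R_NormedModule)). Qed.

Lemma is_derive_C_conj f t l : is_derive_C f t l ->
  is_derive_C (fun s => Cconj (f s)) t (Cconj l).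
Proof.
  rewrite !is_derive_C_iff. intros [H1 H2]. split; [exact H1|].
  exact (is_derive_opp _ _ _ H2).
Qed.

Lemma is_derive_C_inv_at_1 f t l : f t = RtoC 1 -> is_derive_C f t l ->
  is_derive_C (fun s => / f s)%C t (- l)%C.
Proof.
  intros Hf. rewrite !is_derive_C_iff. intros [Da Db].
  set (a := fun s => fst (f s)) in *. set (b := fun s => snd (f s)) in *.
  assert (Ha : a t = 1) by (unfold a; now rewrite Hf).
  assert (Hb : b t = 0) by (unfold b; now rewrite Hf).
  assert (Ea := is_derive_unique _ _ _ Da). assert (Eb := is_derive_unique _ _ _ Db).
  assert (Xa : ex_derive a t) by (eexists; exact Da).
  assert (Xb : ex_derive b t) by (eexists; exact Db).
  split.
  - change (is_derive (fun s => a s / (a s ^ 2 + b s ^ 2)) t (- fst l)).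
    clearbody a b. auto_derive.
    + repeat split; try assumption. rewrite Ha, Hb. lra.
    + change (Derive (fun x => a x)) with (Derive a).
      change (Derive (fun x => b x)) with (Derive b).
      rewrite Ha, Hb, Ea, Eb. field.
  - change (is_derive (fun s => - b s / (a s ^ 2 + b s ^ 2)) t (- snd l)).
    clearbody a b. auto_derive.
    + repeat split; try assumption. rewrite Ha, Hb. lra.
    + change (Derive (fun x => a x)) with (Derive a).
      change (Derive (fun x => b x)) with (Derive b).
      rewrite Ha, Hb, Ea, Eb. field.
Qed.

Lemma Cmod_cis x : Cmod (cis x) <= 1.
Proof.
  unfold Cmod, cis. simpl.
  replace (_ + _) with 1; [rewrite sqrt_1; lra|].
  pose proof (sin2_cos2 x) as E. unfold Rsqr in E. lra.
Qed.

(** The difference [g z - g w] is [(a d - b c) (z - w)] divided by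
    [(c z + d) (c w + d)], and these factors cancel in the cross-ratio. *)
Lemma disk_automorphism_cross_ratio g z1 z2 z3 z4 : disk_automorphism g ->
  Cmod z1 <= 1 -> Cmod z2 <= 1 -> Cmod z3 <= 1 -> Cmod z4 <= 1 ->
  ((g z1 - g z2) * (g z3 - g z4) * ((z1 - z3) * (z2 - z4)) =
   (g z1 - g z3) * (g z2 - g z4) * ((z1 - z2) * (z3 - z4)))%C.
Proof.
  intros [(a & b & c & d & _ & Hg) _] H1 H2 H3 H4.
  destruct (Hg z1 H1) as [D1 ->]. destruct (Hg z2 H2) as [D2 ->].
  destruct (Hg z3 H3) as [D3 ->]. destruct (Hg z4 H4) as [D4 ->].
  field. auto.
Qed.

(** Differentiating the invariance of the cross-ratio of [1], [i], [-1] and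
    [e^(i x)] along the group gives a linear relation that expresses [u x]
    through [u 0], [u (pi/2)] and [u pi]. *)
Lemma first_harmonic_of_moebius u : moebius_lie u -> first_harmonic u.
Proof.
  intros [_ (g & (Hauto & Hid & _) & Hg)]. apply first_harmonic_iff. intros x.
  set (z1 := cis 0). set (z2 := cis (PI / 2)). set (z3 := cis PI). set (z4 := cis x).
  set (V := fun y => (Ci * RtoC (u y) * cis y)%C).
  assert (D : forall y y', is_derive_C (fun t => g t (cis y) - g t (cis y'))%C 0
                             (V y - V y')%C).
  { intros y y'. apply is_derive_C_minus; apply Hg. }
  assert (Dc : forall z : C, is_derive_C (fun _ : R => z) 0 (RtoC 0)).
  { intros z. apply (is_derive_const (K := R_AbsRing) (V := C_R_NormedModule)). }
  assert (DL := is_derive_C_mult _ _ _ _ _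
    (is_derive_C_mult _ _ _ _ _ (D 0 (PI / 2)) (D PI x)) (Dc ((z1 - z3) * (z2 - z4))%C)).
  assert (DR := is_derive_C_mult _ _ _ _ _
    (is_derive_C_mult _ _ _ _ _ (D 0 PI) (D (PI / 2) x)) (Dc ((z1 - z2) * (z3 - z4))%C)).
  assert (E := is_derive_C_unique _ _ _ _
    (is_derive_ext (K := R_AbsRing) (V := C_R_NormedModule) _ _ _ _
       (fun t => disk_automorphism_cross_ratio (g t) z1 z2 z3 z4 (Hauto t)
          (Cmod_cis _) (Cmod_cis _) (Cmod_cis _) (Cmod_cis _)) DL) DR).
  cbv beta in E. rewrite !Hid in E by apply Cmod_cis.
  unfold V, z1, z2, z3, z4, cis in E.
  rewrite cos_0, sin_0, cos_PI, sin_PI, cos_PI2, sin_PI2 in E.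
  pose proof (sin2_cos2 x) as Esc. unfold Rsqr in Esc.
  unfold three_point_interpolation.
  revert E Esc. generalize (cos x) (sin x) (u 0) (u (PI / 2)) (u PI) (u x).
  intros c s u1 u2 u3 u4 E Esc.
  unfold Cmult, Cminus, Cplus, Copp, RtoC, Ci in E. simpl in E.
  injection E as E1 E2.
  set (d := u4 - ((u1 + u3) / 2 + (u1 - u3) / 2 * c + (u2 - (u1 + u3) / 2) * s)).
  (* modulo c^2 + s^2 = 1 the complex relation reads 4 i e^(i x) d = 0, up to sign *)
  assert (F1 : 4 * (s * d) + 2 * (u2 - (u1 + u3) / 2) * (s * s + c * c - 1) = 0).
  { unfold d. match type of E1 with ?l = ?r => transitivity (l - r); [field|lra] end. }
  assert (F2 : 4 * (c * d) + (u1 - u3) * (s * s + c * c - 1) = 0).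
  { unfold d. match type of E2 with ?l = ?r => transitivity (r - l); [field|lra] end. }
  rewrite Esc in F1, F2.
  assert (F : d = 0).
  { replace d with (s * (s * d) + c * (c * d)) by
      (transitivity ((s * s + c * c) * d); [ring|rewrite Esc; ring]).
    replace (s * d) with 0 by lra. replace (c * d) with 0 by lra. ring. }
  unfold d in F. lra.
Qed.

(** The entries of [exp (t X) = c t + s t X] for a traceless matrix [X] with
    [X^2 = delta]. *)
Record exp_pair (delta : R) (c s : R -> R) : Prop := {
  exp_pair_c0 : c 0 = 1;
  exp_pair_s0 : s 0 = 0;
  exp_pair_c_add : forall x y, c (x + y) = c x * c y + delta * (s x * s y);
  exp_pair_s_add : forall x y, s (x + y) = c x * s y + s x * c y;
  exp_pair_det : forall x, c x * c x - delta * (s x * s x) = 1;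
  exp_pair_dc : is_derive c 0 0;
  exp_pair_ds : is_derive s 0 1
}.

Lemma exp_pair_exists delta : exists c s, exp_pair delta c s.
Proof.
  destruct (Rtotal_order delta 0) as [H|[->|H]].
  - set (r := sqrt (- delta)). assert (Hr : r <> 0) by (apply Rgt_not_eq, sqrt_lt_R0; lra).
    assert (Er : delta = - (r * r)) by (unfold r; rewrite sqrt_sqrt; lra).
    clearbody r. subst delta.
    exists (fun t => cos (r * t)), (fun t => sin (r * t) / r). split.
    + now rewrite Rmult_0_r, cos_0.
    + rewrite Rmult_0_r, sin_0. field. exact Hr.
    + intros x y. rewrite Rmult_plus_distr_l, cos_plus. field. exact Hr.
    + intros x y. rewrite Rmult_plus_distr_l, sin_plus. field. exact Hr.
    + intros x. pose proof (sin2_cos2 (r * x)) as E. unfold Rsqr in E.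
      rewrite <- E. field. exact Hr.
    + auto_derive; [exact I|]. rewrite Rmult_0_r, sin_0. ring.
    + auto_derive; [exact I|]. rewrite Rmult_0_r, cos_0. field. exact Hr.
  - exists (fun _ => 1), (fun t => t). split; intros; try ring.
    + auto_derive; [exact I|ring].
    + auto_derive; [exact I|ring].
  - set (r := sqrt delta). assert (Hr : r <> 0) by (apply Rgt_not_eq, sqrt_lt_R0; lra).
    assert (Er : delta = r * r) by (unfold r; rewrite sqrt_sqrt; lra).
    clearbody r. subst delta.
    exists (fun t => (exp (r * t) + exp (- (r * t))) / 2),
           (fun t => (exp (r * t) - exp (- (r * t))) / (2 * r)).
    assert (Ee : forall x, exp x * exp (- x) = 1)
      by (intros x; rewrite <- exp_plus, Rplus_opp_r; apply exp_0).
    split.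
    + rewrite Rmult_0_r, Ropp_0, exp_0. field.
    + rewrite Rmult_0_r, Ropp_0, exp_0. field. exact Hr.
    + intros x y. rewrite Rmult_plus_distr_l, Ropp_plus_distr, !exp_plus. field. exact Hr.
    + intros x y. rewrite Rmult_plus_distr_l, Ropp_plus_distr, !exp_plus. field. exact Hr.
    + intros x. rewrite <- (Ee (r * x)). field. exact Hr.
    + auto_derive; [exact I|]. rewrite Rmult_0_r, Ropp_0, exp_0. field.
    + auto_derive; [exact I|]. rewrite Rmult_0_r, Ropp_0, exp_0. field. exact Hr.
Qed.

Definition norm_sqr (z : C) : R := fst z * fst z + snd z * snd z.

Lemma Cmod_lt_1_iff z : Cmod z < 1 <-> norm_sqr z < 1.
Proof.
  assert (E : norm_sqr z = Cmod z * Cmod z).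
  { unfold Cmod, norm_sqr. rewrite sqrt_sqrt; [ring|nra]. }
  rewrite E. pose proof (Cmod_ge_0 z). split; nra.
Qed.

Lemma Cmod_le_1_iff z : Cmod z <= 1 <-> norm_sqr z <= 1.
Proof.
  assert (E : norm_sqr z = Cmod z * Cmod z).
  { unfold Cmod, norm_sqr. rewrite sqrt_sqrt; [ring|nra]. }
  rewrite E. pose proof (Cmod_ge_0 z). split; nra.
Qed.

Lemma norm_sqr_mult z w : norm_sqr (z * w)%C = norm_sqr z * norm_sqr w.
Proof. destruct z, w. unfold norm_sqr. simpl. ring. Qed.

Lemma norm_sqr_nonneg z : 0 <= norm_sqr z.
Proof. unfold norm_sqr. nra. Qed.

Lemma norm_sqr_eq_0 z : norm_sqr z = 0 -> z = RtoC 0.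
Proof.
  destruct z as [x y]. unfold norm_sqr, RtoC. simpl. intros H. f_equal; nra.
Qed.

(** * Matrices of SU(1,1) acting on the closed disk *)

Definition su_num (p q z : C) : C := (p * z + q)%C.
Definition su_den (p q z : C) : C := (Cconj q * z + Cconj p)%C.

(** The matrix preserves the Hermitian form [|z_2|^2 - |z_1|^2], whose negative,
    null and positive lines are the points outside, on and inside the circle. *)
Lemma su_norm_sqr p q z : norm_sqr p - norm_sqr q = 1 ->
  norm_sqr (su_den p q z) - norm_sqr (su_num p q z) = 1 - norm_sqr z.
Proof.
  intros H. transitivity ((norm_sqr p - norm_sqr q) * (1 - norm_sqr z)).
  - destruct p, q, z. unfold norm_sqr, su_den, su_num, Cconj. simpl. ring.
  - rewrite H. ring.
Qed.

Lemma su_den_neq_0 p q z : norm_sqr p - norm_sqr q = 1 -> norm_sqr z <= 1 ->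
  su_den p q z <> RtoC 0.
Proof.
  intros H Hz HD. assert (E := su_norm_sqr p q z H).
  assert (N0 := norm_sqr_nonneg (su_num p q z)).
  rewrite HD in E. unfold norm_sqr at 1 in E. simpl in E.
  assert (HN : su_num p q z = RtoC 0) by (apply norm_sqr_eq_0; lra).
  (* the matrix has determinant 1, so (N, D) = (0, 0) forces (z, 1) = (0, 0) *)
  assert (E1 : (p * su_den p q z - Cconj q * su_num p q z)%C
               = RtoC (norm_sqr p - norm_sqr q)).
  { destruct p, q, z. unfold norm_sqr, su_den, su_num, Cconj, RtoC, Cmult, Cminus, Cplus, Copp.
    simpl. f_equal; ring. }
  rewrite HD, HN, H in E1. apply (f_equal fst) in E1. simpl in E1. lra.
Qed.

Lemma su_maps_disk p q z : norm_sqr p - norm_sqr q = 1 -> norm_sqr z < 1 ->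
  norm_sqr (su_num p q z / su_den p q z)%C < 1.
Proof.
  intros H Hz. assert (E := su_norm_sqr p q z H).
  assert (HD := su_den_neq_0 p q z H (Rlt_le _ _ Hz)).
  assert (Em := norm_sqr_mult (su_num p q z / su_den p q z)%C (su_den p q z)).
  replace (su_num p q z / su_den p q z * su_den p q z)%C with (su_num p q z) in Em
    by (field; exact HD).
  assert (N0 := norm_sqr_nonneg (su_num p q z)).
  assert (0 < norm_sqr (su_den p q z)) by lra. nra.
Qed.

Definition su_act (p q z : C) : C := (su_num p q z / su_den p q z)%C.

Lemma su_act_automorphism p q : norm_sqr p - norm_sqr q = 1 ->
  (forall w, norm_sqr w < 1 -> exists z, norm_sqr z < 1 /\ su_act p q z = w) ->
  disk_automorphism (su_act p q).
Proof.
  intros H Hsurj. split; [|split].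
  - exists p, q, (Cconj q), (Cconj p). split.
    + replace (p * Cconj p - q * Cconj q)%C with (RtoC (norm_sqr p - norm_sqr q)).
      * rewrite H. intros E. apply (f_equal fst) in E. simpl in E. lra.
      * destruct p, q. unfold norm_sqr, Cconj, RtoC, Cmult, Cminus, Cplus, Copp.
        simpl. f_equal; ring.
    + intros z Hz. split; [|reflexivity].
      apply (su_den_neq_0 p q); [exact H|now apply Cmod_le_1_iff].
  - intros z. rewrite !Cmod_lt_1_iff. now apply su_maps_disk.
  - intros w Hw. apply Cmod_lt_1_iff in Hw.
    destruct (Hsurj w Hw) as (z & Hz & E). exists z.
    split; [now apply Cmod_lt_1_iff|exact E].
Qed.

(** A one-parameter subgroup of SU(1,1), by the first rows of its matrices. *)
Record su_subgroup (p q : R -> C) : Prop := {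
  su_det : forall t, norm_sqr (p t) - norm_sqr (q t) = 1;
  su_p0 : p 0 = RtoC 1;
  su_q0 : q 0 = RtoC 0;
  su_p_add : forall t t', p (t + t') = (p t * p t' + q t * Cconj (q t'))%C;
  su_q_add : forall t t', q (t + t') = (p t * q t' + q t * Cconj (p t'))%C
}.

Lemma su_subgroup_act_0 p q z : su_subgroup p q -> su_act (p 0) (q 0) z = z.
Proof.
  intros H. unfold su_act, su_num, su_den.
  rewrite (su_p0 _ _ H), (su_q0 _ _ H).
  replace (Cconj (RtoC 1)) with (RtoC 1)
    by (unfold Cconj, RtoC; simpl; now rewrite Ropp_0).
  replace (Cconj (RtoC 0)) with (RtoC 0)
    by (unfold Cconj, RtoC; simpl; now rewrite Ropp_0).
  field.
Qed.

Lemma su_subgroup_act_add p q t t' z : su_subgroup p q -> norm_sqr z <= 1 ->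
  su_act (p (t + t')) (q (t + t')) z = su_act (p t) (q t) (su_act (p t') (q t') z).
Proof.
  intros H Hz.
  assert (D1 := su_den_neq_0 _ _ z (su_det _ _ H t') Hz).
  assert (D2 := su_den_neq_0 _ _ z (su_det _ _ H (t + t')) Hz).
  unfold su_act.
  assert (EN : su_num (p (t + t')) (q (t + t')) z =
    (p t * su_num (p t') (q t') z + q t * su_den (p t') (q t') z)%C).
  { unfold su_num, su_den. rewrite (su_p_add _ _ H), (su_q_add _ _ H). ring. }
  assert (ED : su_den (p (t + t')) (q (t + t')) z =
    (Cconj (q t) * su_num (p t') (q t') z + Cconj (p t) * su_den (p t') (q t') z)%C).
  { unfold su_num, su_den. rewrite (su_p_add _ _ H), (su_q_add _ _ H).
    rewrite !Cplus_conj, !Cmult_conj, !Cconj_conj. ring. }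
  rewrite EN, ED in *. clear EN ED. revert D1 D2.
  generalize (su_num (p t') (q t') z) (su_den (p t') (q t') z).
  intros N D D1 D2. unfold su_num, su_den. field. split; [exact D1|exact D2].
Qed.

Lemma su_subgroup_one_parameter p q : su_subgroup p q ->
  one_parameter_group (fun t => su_act (p t) (q t)).
Proof.
  intros H. split; [|split].
  - intros t. apply su_act_automorphism; [apply (su_det _ _ H)|].
    intros w Hw. exists (su_act (p (- t)) (q (- t)) w). split.
    + apply su_maps_disk; [apply (su_det _ _ H)|exact Hw].
    + rewrite <- su_subgroup_act_add by (assumption || lra).
      rewrite Rplus_opp_r. now apply su_subgroup_act_0.
  - intros z _. now apply su_subgroup_act_0.
  - intros t t' z Hz. apply su_subgroup_act_add; [exact H|now apply Cmod_le_1_iff].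
Qed.

(** The denominator is 1 at [t = 0], so the quotient rule reduces to
    [N' - z D']. *)
Lemma su_subgroup_velocity p q dp dq z : su_subgroup p q ->
  is_derive_C p 0 dp -> is_derive_C q 0 dq ->
  is_derive_C (fun t => su_act (p t) (q t) z) 0
    (dp * z + dq - z * (Cconj dq * z + Cconj dp))%C.
Proof.
  intros H Hp Hq.
  assert (M : forall f l, is_derive_C f 0 l -> is_derive_C (fun t => f t * z)%C 0 (l * z)%C).
  { intros f l Hf. replace (l * z)%C with (l * z + f 0 * RtoC 0)%C by ring.
    apply is_derive_C_mult; [exact Hf|apply is_derive_C_const]. }
  assert (HN : is_derive_C (fun t => su_num (p t) (q t) z) 0 (dp * z + dq)%C).
  { apply is_derive_C_plus; [now apply M|exact Hq]. }
  assert (HD : is_derive_C (fun t => su_den (p t) (q t) z) 0 (Cconj dq * z + Cconj dp)%C).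
  { apply is_derive_C_plus; [apply (M (fun t => Cconj (q t)))|];
      now apply is_derive_C_conj. }
  assert (Ec : forall x, Cconj (RtoC x) = RtoC x)
    by (intros x; unfold Cconj, RtoC; simpl; now rewrite Ropp_0).
  assert (D0 : su_den (p 0) (q 0) z = RtoC 1).
  { unfold su_den. rewrite (su_p0 _ _ H), (su_q0 _ _ H), !Ec. ring. }
  assert (N0 : su_num (p 0) (q 0) z = z).
  { unfold su_num. rewrite (su_p0 _ _ H), (su_q0 _ _ H). ring. }
  assert (R := is_derive_C_mult _ _ _ _ _ HN (is_derive_C_inv_at_1 _ _ _ D0 HD)).
  cbv beta in R. rewrite D0, N0 in R.
  refine (eq_ind _ (is_derive_C (fun t => su_act (p t) (q t) z) 0) R _ _).
  match goal with |- ?l = ?r => change (@eq C l r) end. field.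
Qed.

(** The matrices [exp (t X)] for [X] with rows [(i alpha / 2, zeta)] and
    [(conj zeta, - i alpha / 2)], where [zeta = xi + i eta]; then [X^2] is the
    scalar [xi^2 + eta^2 - alpha^2 / 4]. *)
Lemma su_subgroup_exp alpha xi eta c s :
  exp_pair (xi * xi + eta * eta - alpha * alpha / 4) c s ->
  su_subgroup (fun t => (c t, alpha / 2 * s t)) (fun t => (xi * s t, eta * s t)).
Proof.
  intros H. split.
  - intros t. rewrite <- (exp_pair_det _ _ _ H t). unfold norm_sqr. simpl. field.
  - rewrite (exp_pair_c0 _ _ _ H), (exp_pair_s0 _ _ _ H). unfold RtoC. f_equal; ring.
  - rewrite (exp_pair_s0 _ _ _ H). unfold RtoC. f_equal; ring.
  - intros t t'. rewrite (exp_pair_c_add _ _ _ H), (exp_pair_s_add _ _ _ H).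
    unfold Cmult, Cplus, Cconj. simpl. f_equal; field.
  - intros t t'. rewrite (exp_pair_s_add _ _ _ H).
    unfold Cmult, Cplus, Cconj. simpl. f_equal; field.
Qed.

Lemma moebius_of_first_harmonic u : first_harmonic u -> moebius_lie u.
Proof.
  intros Hu. split; [now apply chi_first_harmonic|].
  destruct Hu as (a & b & e & Hu).
  (* the velocity field of the group is alpha + 2 eta cos x - 2 xi sin x *)
  set (xi := - a / 2). set (eta := b / 2).
  destruct (exp_pair_exists (xi * xi + eta * eta - e * e / 4)) as (c & s & H).
  assert (HS := su_subgroup_exp e xi eta c s H).
  eexists. split; [apply (su_subgroup_one_parameter _ _ HS)|]. intros x.
  assert (Dc := exp_pair_dc _ _ _ H). assert (Ds := exp_pair_ds _ _ _ H).
  assert (M : forall k, is_derive (fun t => k * s t) 0 k).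
  { intros k. assert (D := is_derive_scal s 0 k 1 Ds).
    now rewrite Rmult_1_r in D. }
  assert (Hp : is_derive_C (fun t => (c t, e / 2 * s t)) 0 (0, e / 2)).
  { apply is_derive_C_iff. split; [exact Dc|apply M]. }
  assert (Hq : is_derive_C (fun t => (xi * s t, eta * s t)) 0 (xi, eta)).
  { apply is_derive_C_iff. split; apply M. }
  refine (eq_ind _ _ (su_subgroup_velocity _ _ _ _ (cis x) HS Hp Hq) _ _).
  rewrite Hu. unfold cis, Cmult, Cminus, Cplus, Copp, Cconj, RtoC, Ci. simpl.
  pose proof (sin2_cos2 x) as E. unfold Rsqr in E.
  unfold xi, eta. f_equal; apply Rminus_diag_uniq.
  - transitivity (a / 2 * (sin x * sin x + cos x * cos x - 1)); [field|rewrite E; ring].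
  - transitivity (b / 2 * (1 - (sin x * sin x + cos x * cos x))); [field|rewrite E; ring].
Qed.

Lemma moebius_lie_iff u : moebius_lie u <-> first_harmonic u.
Proof. split; [apply first_harmonic_of_moebius|apply moebius_of_first_harmonic]. Qed.

Theorem theorem1p7 (v : R -> R) (hv : chi v) (hcop : coprime_harmonics v) :
  (((exists a b c : R, forall x : R, v x = a * sin x + b * cos x + c) /\
    (forall u : R -> R, Lambda v u <-> moebius_lie u))
   \/ Cinfty_dense (Lambda v))
  /\
  ~ (((exists a b c : R, forall x : R, v x = a * sin x + b * cos x + c) /\
      (forall u : R -> R, Lambda v u <-> moebius_lie u))
     /\ Cinfty_dense (Lambda v)).
Proof.
  split.
  - destruct (classic (exists k, harmonic v k /\ k <> 1%Z /\ k <> (-1)%Z))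
      as [(k & Hk & H1 & H2)|Hno].
    + right. now apply (Lambda_dense v k).
    + left.
      assert (Hv : first_harmonic v).
      { apply first_harmonic_of_harmonics; [exact hv|]. intros k Hk.
        apply NNPP. intros Hne. apply Hno. exists k. tauto. }
      split; [exact Hv|]. intros u. rewrite moebius_lie_iff.
      now apply Lambda_eq_first_harmonic.
  - intros [[Hv _] Hd]. revert Hd. apply first_harmonic_not_dense.
    intros u. now apply Lambda_incl_first_harmonic.
Qed.
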